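(* Let $\mathcal G$ be an étale groupoid and let $(Y,p)$ be a left $\mathcal G$-space. The structure of $\mathcal G$-space of $(Y,p)$ extends in a unique way to the Alexandroff fibrewise compactification $(Y_p^+,p^+)$ and to the Stone–Čech fibrewise compactification $(\beta_pY,p_\beta)$ of $(Y,p)$. This makes them $\mathcal G$-equivariant fibrewise compactifications of $(Y,p)$.
   Context: Conventions. Locally compact spaces are Hausdorff, and second countable except for compactifications such as $\beta_pY$. A locally compact groupoid is a groupoid with a locally compact (Hausdorff, second countable) topology, continuous structure maps and open range and source maps $r,s:\mathcal G\to\mathcal G^{(0)}=X$; it is étale if $r$ is a local homeomorphism. A left $\mathcal G$-space $(Y,p)$ is a locally compact space $Y$ with a continuous map $p:Y\to X$ (not assumed open or surjective) and a continuous map $(\gamma,y)\mapsto\gamma y$ from $\{(\gamma,y):s(\gamma)=p(y)\}$ to $Y$ with $p(\gamma y)=r(\gamma)$, $p(y)y=y$, $(\gamma_2\gamma_1)y=\gamma_2(\gamma_1y)$. A fibrewise compactification of $(Y,p)$ is a triple $(Z,\varphi,q)$ with $Z$ locally compact, $q:Z\to X$ continuous and proper, and $\varphi:Y\to Z$ a homeomorphism onto an open dense subset with $p=q\circ\varphi$. It is $\mathcal G$-equivariant if $(Z,q)$ is a left $\mathcal G$-space with $\varphi(\gamma y)=\gamma\varphi(y)$ whenever $s(\gamma)=p(y)$. Let $p^*C_0(X)=\{f\circ p:f\in C_0(X)\}$ and let $C_0(Y,p)$ be the norm closure in $C_b(Y)$ of the functions whose support is contained in $p^{-1}(K)$ for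 some compact $K\subset X$. Fibrewise compactifications correspond bijectively to $C^*$-algebras $A$ with $p^*C_0(X)+C_0(Y)\subset A\subset C_0(Y,p)$: $Z$ is the Gelfand spectrum of $A$, $\varphi$ comes from the essential ideal $C_0(Y)\subset A$, and $q$ from $f\mapsto f\circ p$. $(Y_p^+,p^+)$ corresponds to $A=p^*C_0(X)+C_0(Y)$ and $(\beta_pY,p_\beta)$ to $A=C_0(Y,p)$. *)

(* Defs.v *)
From HB Require Import structures.
From mathcomp Require Import all_boot all_order all_algebra.
From mathcomp Require Import complex.
From mathcomp Require Import all_classical all_reals all_analysis.

Set Implicit Arguments.
Unset Strict Implicit.
Unset Printing Implicit Defensive.

Import Order.TTheory GRing.Theory Num.Theory.
Import numFieldNormedType.Exports.

Local Open Scope classical_set_scope.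
Local Open Scope ring_scope.

(* The complex numbers, packed as a numClosedFieldType so that they receive the
   topology that MathComp-Analysis puts on every such field. *)
Definition cplx (R : realType) : numClosedFieldType := R[i]%C.

(* For U open: f restricts to a homeomorphism of U onto f(U), and f(U) is open. *)
Definition open_embedding_on (S T : topologicalType) (U : set S) (f : S -> T) :=
  [/\ {within U, continuous f}, set_inj U f &
      forall W : set S, open W -> W `<=` U -> open (f @` W)].

Definition local_homeomorphism (S T : topologicalType) (f : S -> T) :=
  forall x : S, exists U : set S, [/\ open U, U x & open_embedding_on U f].

Definition open_map (S T : topologicalType) (f : S -> T) :=
  forall W : set S, open W -> open (f @` W).

Definition proper_map (S T : topologicalType) (f : S -> T) :=
  forall K : set T, compact K -> compact (f @^-1` K).

(* The unit space is a separate type X, embedded in G by gunit. The product is a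
   total function whose value [gmul g h] matters only if [gsrc g = grng h]. *)
Record groupoid (G X : Type) := Groupoid {
  grng : G -> X;
  gsrc : G -> X;
  gunit : X -> G;
  ginv : G -> G;
  gmul : G -> G -> G;
  grng_unit : forall x, grng (gunit x) = x;
  gsrc_unit : forall x, gsrc (gunit x) = x;
  grng_mul : forall g h, gsrc g = grng h -> grng (gmul g h) = grng g;
  gsrc_mul : forall g h, gsrc g = grng h -> gsrc (gmul g h) = gsrc h;
  gmulA : forall g h k, gsrc g = grng h -> gsrc h = grng k ->
    gmul g (gmul h k) = gmul (gmul g h) k;
  gmul1g : forall g, gmul (gunit (grng g)) g = g;
  gmulg1 : forall g, gmul g (gunit (gsrc g)) = g;
  grng_inv : forall g, grng (ginv g) = gsrc g;
  gsrc_inv : forall g, gsrc (ginv g) = grng g;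
  gmulgV : forall g, gmul g (ginv g) = gunit (grng g);
  gmulVg : forall g, gmul (ginv g) g = gunit (gsrc g)
}.

(* Continuity of gunit and grng makes gunit a homeomorphism of X onto the
   subspace of units of G, and this subspace is closed as G is Hausdorff; so X is
   locally compact, Hausdorff and second countable because G is. *)
Record locally_compact_groupoid (G X : topologicalType) (Gd : groupoid G X) :
    Prop := LocallyCompactGroupoid {
  lcg_locally_compact : locally_compact [set: G];
  lcg_hausdorff : hausdorff_space G;
  lcg_second_countable : @second_countable G;
  lcg_rng_continuous : continuous (grng Gd);
  lcg_src_continuous : continuous (gsrc Gd);
  lcg_unit_continuous : continuous (gunit Gd);
  lcg_inv_continuous : continuous (ginv Gd);
  lcg_mul_continuous :
    {within [set gh : G * G | gsrc Gd gh.1 = grng Gd gh.2],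
      continuous (fun gh : G * G => gmul Gd gh.1 gh.2)};
  lcg_rng_open : open_map (grng Gd);
  lcg_src_open : open_map (gsrc Gd)
}.

Definition etale (G X : topologicalType) (Gd : groupoid G X) :=
  local_homeomorphism (grng Gd).

(* [act g y] matters only if [gsrc Gd g = p y]. Second countability of Y is not
   part of this definition, as it fails for Stone-Cech compactifications. *)
Record left_gspace (G X Y : topologicalType) (Gd : groupoid G X)
    (p : Y -> X) (act : G -> Y -> Y) : Prop := LeftGSpace {
  gsp_locally_compact : locally_compact [set: Y];
  gsp_hausdorff : hausdorff_space Y;
  gsp_anchor_continuous : continuous p;
  gsp_act_continuous :
    {within [set gy : G * Y | gsrc Gd gy.1 = p gy.2],
      continuous (fun gy : G * Y => act gy.1 gy.2)};
  gsp_anchor : forall g y, gsrc Gd g = p y -> p (act g y) = grng Gd g;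
  gsp_unit : forall y, act (gunit Gd (p y)) y = y;
  gsp_mul : forall g2 g1 y, gsrc Gd g1 = p y -> gsrc Gd g2 = grng Gd g1 ->
    act (gmul Gd g2 g1) y = act g2 (act g1 y)
}.

Record fibrewise_compactification (X Y Z : topologicalType)
    (p : Y -> X) (phi : Y -> Z) (q : Z -> X) : Prop := FibrewiseCompactification {
  fc_locally_compact : locally_compact [set: Z];
  fc_hausdorff : hausdorff_space Z;
  fc_continuous : continuous q;
  fc_proper : proper_map q;
  fc_open_embedding : open_embedding_on [set: Y] phi;
  fc_dense : dense (range phi);
  fc_commute : forall y, q (phi y) = p y
}.

(* actZ is a G-space structure on (Z, q) which extends, along phi, the G-space
   structure act of (Y, p). *)
Definition equivariant_extension (G X Y Z : topologicalType)
    (Gd : groupoid G X) (p : Y -> X) (act : G -> Y -> Y)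
    (phi : Y -> Z) (q : Z -> X) (actZ : G -> Z -> Z) :=
  left_gspace Gd q actZ /\
  forall g y, gsrc Gd g = p y -> phi (act g y) = actZ g (phi y).

Definition C0 (R : realType) (T : topologicalType) : set (T -> cplx R) :=
  [set f | continuous f /\
     forall e : cplx R, 0 < e -> compact [set x | e <= `|f x|]].

Definition Cb (R : realType) (T : topologicalType) : set (T -> cplx R) :=
  [set f | continuous f /\ exists M : cplx R, forall x, `|f x| <= M].

(* p^*C_0(X) + C_0(Y) *)
Definition alexandroff_algebra (R : realType) (X Y : topologicalType)
    (p : Y -> X) : set (Y -> cplx R) :=
  [set h | exists f g, [/\ C0 f, C0 g & h = (f \o p) \+ g]].

(* C_0(Y, p): the closure, for the sup norm of C_b(Y), of the functions whose
   support is contained in the inverse image of a compact subset of X. *)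
Definition stone_cech_algebra (R : realType) (X Y : topologicalType)
    (p : Y -> X) : set (Y -> cplx R) :=
  [set f | Cb f /\ forall e : cplx R, 0 < e -> exists g : Y -> cplx R,
     [/\ Cb g,
         exists2 K : set X, compact K &
           closure [set y | g y != 0] `<=` p @^-1` K &
         forall y, `|f y - g y| <= e]].

(* Nonzero *-homomorphisms from A to the complex numbers. As the type [set_type A]
   of elements of A carries no operations, each clause quantifies over elements
   of A whose underlying functions satisfy the relevant equation. *)
Record is_character (R : realType) (Y : Type) (A : set (Y -> cplx R))
    (chi : A -> cplx R) : Prop := IsCharacter {
  char_add : forall a b c : A,
    set_val c = set_val a \+ set_val b -> chi c = chi a + chi b;
  char_scale : forall (k : cplx R) (a b : A),
    set_val b = k \*o set_val a -> chi b = k * chi a;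
  char_mul : forall a b c : A,
    set_val c = set_val a \* set_val b -> chi c = chi a * chi b;
  char_conj : forall a b : A,
    set_val b = (fun y => (set_val a y)^*) -> chi b = (chi a)^*;
  char_neq0 : exists a : A, chi a != 0
}.

(* The characters of A with the topology of pointwise convergence on A. *)
Definition gelfand_spectrum (R : realType) (Y : Type) (A : set (Y -> cplx R)) :
    topologicalType :=
  set_type ([set chi | is_character chi] : set {ptws A -> cplx R}).

(* The maps that come with the spectrum of an algebra A such that
   p^*C_0(X) + C_0(Y) `<=` A `<=` C_0(Y, p). For the ideal C_0(Y) of A, the point
   y of Y (the spectrum of C_0(Y)) corresponds to the character of A extending
   evaluation at y, which is again evaluation at y. The map q is dual to
   f |-> f \o p: the point q chi of X (the spectrum of C_0(X)) is the one at which
   the character f |-> chi (f \o p) of C_0(X) evaluates. *)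
Record gelfand_maps (R : realType) (X Y : topologicalType) (p : Y -> X)
    (A : set (Y -> cplx R)) (phi : Y -> gelfand_spectrum A)
    (q : gelfand_spectrum A -> X) : Prop := GelfandMaps {
  gm_eval : forall (y : Y) (a : A), set_val (phi y) a = set_val a y;
  gm_dual : forall (chi : gelfand_spectrum A) (f : X -> cplx R) (a : A),
    C0 f -> set_val a = f \o p -> set_val chi a = f (q chi)
}.

(* Actions are compared only at the pairs where they are meaningful. *)
Definition action_extends_uniquely (R : realType) (G X Y : topologicalType)
    (Gd : groupoid G X) (p : Y -> X) (act : G -> Y -> Y)
    (A : set (Y -> cplx R)) :=
  (exists (phi : Y -> gelfand_spectrum A) (q : gelfand_spectrum A -> X),
     gelfand_maps p phi q) /\
  forall (phi : Y -> gelfand_spectrum A) (q : gelfand_spectrum A -> X),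
    gelfand_maps p phi q ->
    fibrewise_compactification p phi q /\
    exists2 actZ : G -> gelfand_spectrum A -> gelfand_spectrum A,
      equivariant_extension Gd p act phi q actZ &
      forall actZ' : G -> gelfand_spectrum A -> gelfand_spectrum A,
        equivariant_extension Gd p act phi q actZ' ->
        forall g z, gsrc Gd g = q z -> actZ' g z = actZ g z.

(* Main.v *)
Require Import Defs.
From mathcomp Require Import all_boot all_order all_algebra.
From mathcomp Require Import complex.
From mathcomp Require Import all_classical all_reals all_analysis.
From mathcomp Require Import ring.

Set Implicit Arguments.
Unset Strict Implicit.
Unset Printing Implicit Defensive.

Import Order.TTheory GRing.Theory Num.Theory.
Import numFieldNormedType.Exports.

Local Open Scope classical_set_scope.
Local Open Scope ring_scope.

(* The Gelfand spectrum of an algebra A is studied through a single analytic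
   property: if a + c is bounded below by a positive constant on Y, with c > 0, then
   a / (a + c) lies in A again, so that no character takes the value - c at a. Applied to
   the sum of the |a_i - chi(a_i)|^2, it shows that each character chi is a limit of
   evaluations at points of Y; bounds, density, the anchor map q and the points of
   C_0(Y) follow by compactness arguments along the filter of chi on Y.

   The action is extended by continuity: g chi is the limit of h y as h tends to g
   and y to chi with s(h) = p(y). If U is an open bisection around g and f in C_0(X)
   is supported in s(U) with f(s(g)) = 1, the function y |-> f(p y) a(h y), where h is
   the element of U with source p(y), belongs to A, whence the limit and its
   continuity. Uniqueness and the axioms of an action pass to the limit, as s is
   open and Y is dense. *)

(** * Complex-valued continuous functions *)

Section complex_topology.
Variable R : realType.
Local Notation C := (cplx R).

Lemma gt0_realC (e : C) : 0 < e -> exists2 r : R, 0 < r & e = (r%:C)%C.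
Proof.
move=> e0; exists (complex.Re e); first by move: e0; rewrite ltcE => /andP[].
by move: e0; rewrite ltcE => /andP[/eqP/= e0 _]; case: e e0 => a b /= ->.
Qed.

Lemma continuous_realC : continuous (fun a : R => (a%:C)%C : C).
Proof.
move=> a; apply/cvgrPdist_lt => e /gt0_realC[r r0 ->].
near=> b.
rewrite -rmorphB normc_def /= expr0n addr0 sqrtr_sqr ltcR.
near: b; apply: cvgr_dist_lt => //.
Unshelve. all: by end_near. Qed.

Section norm_sets.
Variables (T : topologicalType) (f : T -> C).
Hypothesis cf : continuous f.

Lemma open_norm_lt (e : C) : open [set x | `|f x| < e].
Proof.
rewrite openE => x /= fxe; rewrite /interior /=.
have d0 : 0 < e - `|f x| by rewrite subr_gt0.
have /cvgrPdist_lt /(_ _ d0) := @cf x; apply: filterS => y /= fy.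
rewrite -(subrK (f x) (f y)) (le_lt_trans (ler_normD _ _))// -ltrBrDr.
by rewrite distrC.
Qed.

Lemma open_norm_gt (e : C) : open [set x | e < `|f x|].
Proof.
rewrite openE => x /= fxe; rewrite /interior /=.
have d0 : 0 < `|f x| - e by rewrite subr_gt0.
have /cvgrPdist_lt /(_ _ d0) := @cf x; apply: filterS => y /= fy.
rewrite ltrBrDl in fy; rewrite -(ltrD2r `|f x - f y|) (lt_le_trans fy)//.
by rewrite -{1}(subrK (f y) (f x)) addrC ler_normD.
Qed.

Lemma closed_norm_ge (e : C) : e \is Num.real -> closed [set x | e <= `|f x|].
Proof.
move=> er; rewrite (_ : [set _ | _] = ~` [set x | `|f x| < e]).
  by rewrite closedC; exact: open_norm_lt.
by apply/seteqP; split=> x /=; rewrite real_leNgt ?normr_real// => /negP.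
Qed.

Lemma closed_norm_le (e : C) : e \is Num.real -> closed [set x | `|f x| <= e].
Proof.
move=> er; rewrite (_ : [set _ | _] = ~` [set x | e < `|f x|]).
  by rewrite closedC; exact: open_norm_gt.
by apply/seteqP; split=> x /=; rewrite real_leNgt ?normr_real// => /negP.
Qed.

Lemma compact_norm_bounded (K : set T) : compact K ->
  exists2 M : C, 0 < M & forall x, K x -> `|f x| <= M.
Proof.
rewrite compact_near_coveringP => /(_ C +oo (fun M x => `|f x| <= M)).
case=> [x Kx|].
  have : \forall x' \near x, `|f x'| < `|f x| + 1.
    have oU := open_norm_lt (`|f x| + 1).
    by apply: open_nbhs_nbhs; split => //=; rewrite ltrDl.
  move=> nx; near=> y M => /=.
  apply: (@le_trans _ _ (`|f x| + 1)).
    by apply: ltW; near: y.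
  near: M; apply: nbhs_pinfty_ge; exact: ger0_real.
move=> M [Mr KM]; exists (`|M| + 1); first by rewrite ltr_wpDl.
move=> x Kx; apply: (KM (`|M| + 1)) => //.
by rewrite (le_lt_trans (real_ler_norm Mr))// ltrDl.
Unshelve. all: by end_near. Qed.

End norm_sets.

(** The disc is a closed subset of the image of a compact square under (a, b) |-> a + ib. It
    supplies the limits of bounded values along ultrafilters. *)
Lemma compact_disc (M : C) : compact [set z : C | `|z| <= M].
Proof.
(* Here [M] is any complex number; unless it is real and nonnegative, it bounds no norm and the disc
   is empty. *)
have [M0|/negbTE M0] := boolP (0 <= M); last first.
  rewrite (_ : [set _ | _] = set0); first exact: compact0.
  rewrite -subset0 => z /= zM.
  by rewrite (le_trans (normr_ge0 z) zM) in M0.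
pose m := complex.Re M.
pose S := `[-m, m]%classic : set R.
pose F (ab : R * R) : C := (ab.1%:C)%C + 'i * (ab.2%:C)%C.
have cF : continuous F.
  move=> ab; apply: cvgD.
    apply: (@cvg_comp _ _ _ fst (fun a => (a%:C)%C : C) _ (nbhs ab.1)).
      exact: cvg_fst.
    exact: continuous_realC.
  apply: cvgMr.
  apply: (@cvg_comp _ _ _ snd (fun a => (a%:C)%C : C) _ (nbhs ab.2)).
    exact: cvg_snd.
  exact: continuous_realC.
have cK : compact (F @` (S `*` S)).
  apply: continuous_compact; first exact: continuous_subspaceT.
  by apply: compact_setX; exact: segment_compact.
apply: (subclosed_compact _ cK).
  by apply: (@closed_norm_le _ id) => //; [move=> z; exact: cvg_id|exact: ger0_real].
move=> z /= zM.
have RM : (m%:C)%C = M by rewrite (RRe_real (ger0_real M0)).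
exists (complex.Re z, complex.Im z); last by rewrite /F /= -complexE.
have h (t : R) : (`|t|%:C)%C <= `|z| -> S t.
  by move=> tz; rewrite /S /= in_itv /= -ler_norml -lecR (le_trans tz)// RM.
split; apply: h.
  exact: normc_ge_Re.
rewrite normc_def lecR -sqrtr_sqr; apply: ler_wsqrtr.
by rewrite lerDr sqr_ge0.
Qed.

End complex_topology.

(** * Functions vanishing at infinity *)

Section vanishing_functions.
Variables (R : realType) (T : topologicalType).
Local Notation C := (cplx R).
Implicit Types (f g : T -> C) (K : set T).

Lemma cvg_conj (I : Type) (F : set_system I) (FF : Filter F) (f : I -> C) (z : C) :
  f @ F --> z -> (fun i => (f i)^*) @ F --> z^*.
Proof.
move=> /cvgrPdist_lt fz; apply/cvgrPdist_lt => e /fz.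
by apply: filterS => i /=; rewrite -rmorphB norm_conjC.
Qed.

Lemma continuous_addf f g :
  continuous f -> continuous g -> continuous (f \+ g).
Proof. by move=> cf cg x; apply: cvgD; [exact: cf|exact: cg]. Qed.

Lemma continuous_mulf f g :
  continuous f -> continuous g -> continuous (f \* g).
Proof. by move=> cf cg x; apply: cvgM; [exact: cf|exact: cg]. Qed.

Lemma continuous_conjf f : continuous f -> continuous (fun x => (f x)^*).
Proof. by move=> cf x; apply: cvg_conj; exact: cf. Qed.

Lemma C0_of_subcompact f : continuous f ->
  (forall e : C, 0 < e -> exists2 K, compact K & [set x | e <= `|f x|] `<=` K) ->
  C0 f.
Proof.
move=> cf fK; split=> // e e0; have [K cK sK] := fK e e0.
by apply: (subclosed_compact _ cK sK); apply: closed_norm_ge; rewrite ?gtr0_real.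
Qed.

Lemma C0_dominated f g (M : C) : C0 f -> continuous g -> 0 < M ->
  (forall x, `|g x| <= M * `|f x|) -> C0 g.
Proof.
move=> [cf f0] cg M0 gf; apply: C0_of_subcompact => // e e0.
exists [set x | e / M <= `|f x|]; first by apply: f0; rewrite divr_gt0.
by move=> x /= ex; rewrite ler_pdivrMr// mulrC (le_trans ex).
Qed.

Lemma C0_bounded f : C0 f -> exists2 M : C, 0 < M & forall x, `|f x| <= M.
Proof.
move=> [cf f0]; have [M M0 fM] := compact_norm_bounded cf (f0 1 ltr01).
exists (M + 1) => [|x]; first by rewrite addr_gt0.
have [f1|f1] := real_leP (@real1 C) (normr_real (f x)).
  by rewrite (le_trans (fM _ f1))// lerDl.
by rewrite (le_trans (ltW f1))// lerDr ltW.
Qed.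

Lemma C0_0 : C0 (cst 0 : T -> C).
Proof.
apply: C0_of_subcompact => [|e e0]; first by move=> x; exact: cvg_cst.
exists set0; first exact: compact0.
by move=> x /=; rewrite normr0 => /(lt_le_trans e0); rewrite ltxx.
Qed.

Lemma C0_add f g : C0 f -> C0 g -> C0 (f \+ g).
Proof.
move=> [cf f0] [cg g0]; apply: C0_of_subcompact; first exact: (continuous_addf cf cg).
move=> e e0; have e2 : 0 < e / 2 by rewrite divr_gt0.
exists ([set x | e / 2 <= `|f x|] `|` [set x | e / 2 <= `|g x|]).
  by apply: compactU; [exact: f0|exact: g0].
move=> x /= ex; have e2r := gtr0_real e2.
have [?|fx] := real_leP e2r (normr_real (f x)); first by left.
have [?|gx] := real_leP e2r (normr_real (g x)); first by right.
have := le_lt_trans (ler_normD _ _) (ltrD fx gx).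
by rewrite -splitr => /(le_lt_trans ex); rewrite ltxx.
Qed.

Lemma C0_mul f g (M : C) : C0 f -> continuous g -> 0 < M ->
  (forall x, `|g x| <= M) -> C0 (g \* f).
Proof.
move=> f0 cg M0 gM; have [cf _] := f0.
apply: (C0_dominated f0 (continuous_mulf cg cf) M0) => x /=.
by rewrite normrM ler_wpM2r.
Qed.

Lemma C0_scale (k : C) f : C0 f -> C0 (k \*o f).
Proof.
move=> f0; have ck : continuous (cst k : T -> C) by move=> x; exact: cvg_cst.
have k0 : 0 < `|k| + 1 by rewrite ltr_wpDl.
by apply: (C0_mul f0 ck k0) => x; rewrite lerDl.
Qed.

Lemma C0_conj f : C0 f -> C0 (fun x => (f x)^*).
Proof.
move=> f0; have [cf _] := f0.
apply: (C0_dominated f0 (continuous_conjf cf) ltr01) => x.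
by rewrite norm_conjC mul1r.
Qed.

Hypothesis lcT : locally_compact [set: T].
Hypothesis hT : hausdorff_space T.

(** By regularity, [x] has a neighbourhood [W] whose closure is compact and contained in [U].
    Complete regularity separates [x] from the complement of the interior of [W]; one minus the
    separating function vanishes off the closure of [W]. *)
Lemma C0_urysohn (x : T) (U : set T) : open U -> U x ->
  exists2 f : T -> C, [/\ C0 f, f x = 1 & forall y, `|f y| <= 1] &
    exists2 K, compact K /\ K `<=` U & forall y, f y != 0 -> K y.
Proof.
move=> oU Ux; have [K] := lcT (x := x) I; rewrite withinET => Kx [cK clK].
pose V := U `&` K°.
have oV : open V by apply: openI => //; exact: open_interior.
have Vx : V x by split.
have [W Wx WV] : filter_from (nbhs x) closure V.
  by apply: (compact_regular hT cK Kx); exact: open_nbhs_nbhs.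
pose B := ~` (W°).
have sep : uniform_separator [set x] B.
  apply: (@locally_compact_completely_regular _ R) => //.
    by rewrite closedC; exact: open_interior.
have [f [cf f01 fx fB]] := (@uniform_separatorP _ R _ _).1 sep.
have f0 y : 0 <= f y <= 1 by have := f01 (f y); rewrite /= in_itv /=; apply; exists y.
have cW : compact (closure W).
  apply: (subclosed_compact _ cK); first exact: closed_closure.
  by move=> y /WV[_ /interior_subset]; apply.
have fW y : ((1 - f y)%:C)%C != 0 :> C -> closure W y.
  apply: contra_neqP => Wy; rewrite (fB (f y)) ?subrr//.
  by exists y => // Wy'; apply: Wy; apply: subset_closure; exact: interior_subset.
exists (fun y => ((1 - f y)%:C)%C); last first.
  by exists (closure W) => //; split => // y /WV[].
split.
- apply: C0_of_subcompact.
    move=> y.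
    apply: (@cvg_comp _ _ _ (fun y => 1 - f y) (fun a => (a%:C)%C : C));
      last exact: continuous_realC.
    by apply: cvgB; [exact: cvg_cst|exact: cf].
  move=> e e0; exists (closure W) => // y /= ey.
  by apply: fW; rewrite -normr_gt0; exact: (lt_le_trans e0 ey).
- have -> : f x = 0 by apply: fx; exists x.
  by rewrite subr0.
- move=> y; rewrite normc_def /= expr0n addr0 sqrtr_sqr lecR.
  by have /andP[? ?] := f0 y; rewrite ger0_norm ?subr_ge0// gerBl.
Qed.

End vanishing_functions.

(** * Characters *)

Lemma cvg_initial (S : choiceType) (T : topologicalType) (f : S -> T)
    (F : set_system S) (s : S) : Filter F ->
  f @ F --> f s -> F --> (s : initial_topology f).
Proof.
move=> FF Fs U [_ [[V oV <-] Vs VU]].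
have /Fs fV : nbhs (f s) V by exact: open_nbhs_nbhs.
by rewrite nbhs_filterE; apply: (filterS VU); exact: fV.
Qed.

Lemma cvg_ptws (I : eqType) (T : topologicalType) (J : Type) (F : set_system J)
    (u : J -> {ptws I -> T}) (l : {ptws I -> T}) : Filter F ->
  (forall i, (fun j => u j i) @ F --> l i) -> u @ F --> l.
Proof.
move=> FF ul; apply/cvg_sup => i.
by apply: (@cvg_initial _ _ (fun f : {ptws I -> T} => f i)); exact: ul.
Qed.

Section spectrum_valuation.
Variables (R : realType) (Y : Type) (A : set (Y -> cplx R)).
Local Notation C := (cplx R).
Local Notation Z := (gelfand_spectrum A).
Implicit Types (a b : Y -> C) (z : Z).

Definition gelem a (Aa : A a) : A := exist _ a (mem_set Aa).

Lemma gelemP (x : A) : A (set_val x).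
Proof. exact: set_valP. Qed.

(** Extension of a character by 0 outside [A], so that it can be applied to plain functions on [Y]
    instead of elements of a subtype. *)
Definition gval z a : C :=
  if pselect (A a) is left Aa then set_val z (gelem Aa) else 0.

Lemma gvalE z (a : A) : gval z (set_val a) = set_val z a.
Proof.
rewrite /gval; case: pselect => [Aa|[]]; last exact: gelemP.
by congr (set_val z _); apply/val_inj.
Qed.

Lemma gval_elem z a (Aa : A a) : gval z a = set_val z (gelem Aa).
Proof. exact: (gvalE z (gelem Aa)). Qed.

Lemma gelfand_character z : is_character (set_val z : A -> C).
Proof. by case: z => chi /= h; have := set_mem h. Qed.

Lemma gval_add z a b : A a -> A b -> A (a \+ b) ->
  gval z (a \+ b) = gval z a + gval z b.
Proof.
move=> Aa Ab Aab; rewrite (gval_elem z Aa) (gval_elem z Ab) (gval_elem z Aab).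
exact: (char_add (gelfand_character z)).
Qed.

Lemma gval_scale z (k : C) a : A a -> A (k \*o a) ->
  gval z (k \*o a) = k * gval z a.
Proof.
move=> Aa Ab; rewrite (gval_elem z Aa) (gval_elem z Ab).
exact: (char_scale (gelfand_character z)).
Qed.

Lemma gval_mul z a b : A a -> A b -> A (a \* b) ->
  gval z (a \* b) = gval z a * gval z b.
Proof.
move=> Aa Ab Aab; rewrite (gval_elem z Aa) (gval_elem z Ab) (gval_elem z Aab).
exact: (char_mul (gelfand_character z)).
Qed.

Lemma gval_conj z a : A a -> A (fun y => (a y)^*) ->
  gval z (fun y => (a y)^*) = (gval z a)^*.
Proof.
move=> Aa Ab; rewrite (gval_elem z Aa) (gval_elem z Ab).
exact: (char_conj (gelfand_character z)).
Qed.

Lemma gval_neq0 z : exists2 a, A a & gval z a != 0.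
Proof.
have [a za] := char_neq0 (gelfand_character z).
by exists (set_val a); [exact: gelemP|rewrite gvalE].
Qed.

Lemma gval_inj z w : (forall a, A a -> gval z a = gval w a) -> z = w.
Proof.
move=> zw; apply/val_inj/funext => a.
by have := zw _ (gelemP a); rewrite !gvalE.
Qed.

Lemma continuous_gval a : A a -> continuous (fun z => gval z a).
Proof.
move=> Aa.
rewrite (_ : (fun z => _) =
  (fun chi : {ptws A -> C} => chi (gelem Aa)) \o set_val).
  move=> z; apply: continuous_comp; first exact: initial_continuous.
  exact: (@proj_continuous _ (fun _ : A => C : topologicalType)).
by apply/funext => z; rewrite (gval_elem z Aa).
Qed.

Lemma cvg_spectrum (I : Type) (F : set_system I) (u : I -> Z) z : Filter F ->
  (forall a, A a -> (fun i => gval (u i) a) @ F --> gval z a) -> u @ F --> z.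
Proof.
move=> FF uz.
apply: (@cvg_initial _ _ (set_val : Z -> {ptws A -> C})).
apply: cvg_ptws => a.
have := uz _ (gelemP a); rewrite gvalE.
by under eq_fun do rewrite gvalE.
Qed.

Lemma hausdorff_spectrum : hausdorff_space Z.
Proof.
move=> z w zw; apply: gval_inj => a Aa.
have hC : hausdorff_space C by exact: norm_hausdorff.
apply: hC => U V Uz Vw.
have [t [Ut Vt]] := zw _ _ (continuous_gval Aa Uz) (continuous_gval Aa Vw).
by exists (gval t a).
Qed.

(** Characters are built below as pointwise limits, which are chosen as functionals on all functions
    but controlled only on [A]. *)
Lemma spectrum_of (chi : (Y -> C) -> C) :
  (forall a b, A a -> A b -> A (a \+ b) -> chi (a \+ b) = chi a + chi b) ->
  (forall k a, A a -> A (k \*o a) -> chi (k \*o a) = k * chi a) ->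
  (forall a b, A a -> A b -> A (a \* b) -> chi (a \* b) = chi a * chi b) ->
  (forall a, A a -> A (fun y => (a y)^*) -> chi (fun y => (a y)^*) = (chi a)^*) ->
  (exists2 a, A a & chi a != 0) ->
  exists z, forall a, A a -> gval z a = chi a.
Proof.
move=> chiD chiZ chiM chiC [a Aa a0].
pose c : A -> C := fun x => chi (set_val x).
have hc : @is_character R Y A c.
  split; rewrite /c.
  - move=> x y w h; have := gelemP w; rewrite h => Aw.
    exact: (chiD _ _ (gelemP x) (gelemP y) Aw).
  - move=> k x w h; have := gelemP w; rewrite h => Aw.
    exact: (chiZ _ _ (gelemP x) Aw).
  - move=> x y w h; have := gelemP w; rewrite h => Aw.
    exact: (chiM _ _ (gelemP x) (gelemP y) Aw).
  - move=> x w h; have := gelemP w; rewrite h => Aw.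
    exact: (chiC _ (gelemP x) Aw).
  - by exists (gelem Aa).
exists (exist _ c (mem_set hc) : Z) => b Ab.
by rewrite (gval_elem _ Ab).
Qed.

End spectrum_valuation.

(** * Algebras between C_0(Y) and C_b(Y) *)

(** What the Alexandroff and Stone-Čech algebras share and the study of the spectrum needs. The
    inclusion in C_0(Y, p) is expressed by [fa_vanish], through level sets. *)
Record fibre_algebra (R : realType) (X Y : topologicalType) (p : Y -> X)
    (A : set (Y -> cplx R)) : Prop := FibreAlgebra {
  fa_continuous : forall a, A a -> continuous a;
  fa_bounded : forall a, A a ->
    exists2 M : cplx R, 0 < M & forall y, `|a y| <= M;
  fa_vanish : forall a (e : cplx R), A a -> 0 < e ->
    exists2 K : set X, compact K & forall y, e <= `|a y| -> K (p y);
  fa_C0 : forall a, C0 a -> A a;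
  fa_pullback : forall f : X -> cplx R, C0 f -> A (f \o p);
  fa_add : forall a b, A a -> A b -> A (a \+ b);
  fa_scale : forall (k : cplx R) a, A a -> A (k \*o a);
  fa_mul : forall a b, A a -> A b -> A (a \* b);
  fa_conj : forall a, A a -> A (fun y => (a y)^*);
  (* Stands in for the completeness of A, and is easier to check. *)
  fa_quot : forall a (c d : cplx R), A a -> 0 < c -> 0 < d ->
    (forall y, d <= a y + c) -> A (fun y => a y / (a y + c))
}.

(** * Characters as limits of evaluations at points of Y *)

Section fibre_algebra_spectrum.
Variables (R : realType) (X Y : topologicalType) (p : Y -> X).
Local Notation C := (cplx R).
Variable A : set (Y -> C).
Hypothesis fA : fibre_algebra p A.
Local Notation Z := (gelfand_spectrum A).
Implicit Types (a b : Y -> C) (z : Z).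

Lemma fa_0 : A (cst 0).
Proof. exact: (fa_C0 fA (C0_0 _ _)). Qed.

Lemma gval0 z : gval z (cst 0) = 0.
Proof.
have h : cst 0 = 0 \*o cst 0 :> (Y -> C) by apply/funext => y /=; rewrite mul0r.
have A0 : A (0 \*o cst 0) by rewrite -h; exact: fa_0.
by rewrite h (gval_scale z fa_0 A0) mul0r.
Qed.

(** With b = a / (a + c) in [A], one has c b + a b = a. If the character took the value - c at [a],
    it would kill the left-hand side, giving 0 = - c. This form avoids the constants, which need not
    lie in [A]. *)
Lemma gval_range z a (c d : C) : A a -> 0 < c -> 0 < d ->
  (forall y, d <= a y + c) -> gval z a != - c.
Proof.
move=> Aa c0 d0 ac; apply/eqP => zac.
have Ab := fa_quot fA Aa c0 d0 ac.
set b := (fun y => _) in Ab.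
have E : (c \*o b) \+ (a \* b) = a.
  apply/funext => y /=; rewrite -mulrDl /b mulrCA addrC divff ?mulr1//.
  by rewrite gt_eqF// (lt_le_trans d0).
have := congr1 (gval z) E.
rewrite gval_add ?E//; [|exact: (fa_scale fA)|exact: (fa_mul fA)].
rewrite gval_scale//; last exact: (fa_scale fA).
rewrite gval_mul//; last exact: (fa_mul fA).
rewrite -mulrDl zac subrr mul0r => /esym/eqP.
by rewrite oppr_eq0 gt_eqF.
Qed.

(** The function |a - z(a)|^2 may fail to be in [A], which need not contain constants. Expanding it
    and dropping the constant term |z(a)|^2 leaves the element [b] of [A]. *)
Lemma gval_sqdist z a : A a -> exists2 b, A b &
  gval z b = - `|gval z a| ^+ 2 /\
  forall y, b y + `|gval z a| ^+ 2 = `|a y - gval z a| ^+ 2.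
Proof.
move=> Aa; set w := gval z a.
have Ac := fa_conj fA Aa.
pose ac : Y -> C := fun y => (a y)^*.
have A1 : A (a \* ac) by exact: (fa_mul fA).
have A2 : A ((- w^*) \*o a) by exact: (fa_scale fA).
have A3 : A ((- w) \*o ac) by exact: (fa_scale fA).
have A4 := fa_add fA A1 A2.
have A5 := fa_add fA A4 A3.
exists (((a \* ac) \+ ((- w^*) \*o a)) \+ ((- w) \*o ac)) => //; split.
  rewrite (gval_add _ A4 A3 A5) (gval_add _ A1 A2 A4) (gval_scale _ Aa A2).
  rewrite (gval_scale _ Ac A3) (gval_mul _ Aa Ac A1) (gval_conj _ Aa Ac) -/w.
  by rewrite normCK; ring.
by move=> y /=; rewrite !normCK rmorphB /ac /=; ring.
Qed.

(* The trace on Y of the neighbourhood filter of z. Its base uses a single element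
   a of A, meant to be a sum of |b - z(b)|^2 - |z(b)|^2, with c the sum of the
   |z(b)|^2; this avoids finite families. *)
Definition near_char z : set_system Y := [set S | exists a (c d : C),
  [/\ A a, gval z a = - c, 0 <= c, 0 < d &
      (forall y, 0 <= a y + c) /\ forall y, a y + c < d -> S y]].

Lemma pos_lower_bound (d1 d2 : C) : 0 < d1 -> 0 < d2 ->
  exists2 d, 0 < d & d <= d1 /\ d <= d2.
Proof.
move=> d10 d20; have [d12|d21] := real_leP (gtr0_real d10) (gtr0_real d20).
  by exists d1.
by exists d2 => //; split=> //; exact: ltW.
Qed.

(** Properness is where [gval_range] enters: an empty base set would bound a + c below by d > 0.
    Intersections are obtained by adding the witnesses. *)
#[local] Instance near_char_filter z : ProperFilter (near_char z).
Proof.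
split.
  move=> [a [c [d [Aa za c0 d0 [ac ad]]]]].
  (* The constant [c] may be 0, whereas [gval_range] wants a positive one. Adding the squared
     distance of an element on which [z] does not vanish makes it positive. *)
  have [a0 Aa0 za0] := gval_neq0 z.
  have [b Ab [zb bw]] := gval_sqdist z Aa0.
  set m := `|gval z a0| ^+ 2 in zb bw.
  have m0 : 0 < m by rewrite exprn_gt0// normr_gt0.
  have Aab := fa_add fA Aa Ab.
  have : gval z (a \+ b) != - (c + m).
    apply: (gval_range _ Aab _ d0); first by rewrite ltr_wpDl.
    move=> y /=; rewrite addrACA bw.
    have : d <= a y + c.
      rewrite real_leNgt ?ger0_real//; last exact: ltW.
      by apply/negP => /ad.
    by move=> h; rewrite (le_trans h)// lerDl exprn_ge0.
  by rewrite (gval_add _ Aa Ab Aab) za zb opprD eqxx.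
split.
- exists (cst 0), 0, 1; split=> //; first exact: fa_0.
    by rewrite gval0 oppr0.
  by split=> // y /=; rewrite addr0.
- move=> S T [a [c [d [Aa za c0 d0 [ac aS]]]]] [b [c' [d' [Ab zb c'0 d'0 [bc bT]]]]].
  have [e e0 [ed ed']] := pos_lower_bound d0 d'0.
  have Aab := fa_add fA Aa Ab.
  exists (a \+ b), (c + c'), e; split=> //.
  + by rewrite (gval_add _ Aa Ab Aab) za zb opprD.
  + exact: addr_ge0.
  + split=> y /=; rewrite addrACA; first exact: addr_ge0.
    move=> h; split.
      by apply: aS; rewrite (lt_le_trans _ ed)// (le_lt_trans _ h)// lerDl.
    by apply: bT; rewrite (lt_le_trans _ ed')// (le_lt_trans _ h)// lerDr.
- move=> S T ST [a [c [d [Aa za c0 d0 [ac aS]]]]].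
  by exists a, c, d; split=> //; split=> // y /aS/ST.
Qed.

Lemma near_char_cvg z a : A a -> a @ near_char z --> gval z a.
Proof.
move=> Aa; apply/cvgrPdist_lt => e e0.
have [b Ab [zb bw]] := gval_sqdist z Aa.
exists b, (`|gval z a| ^+ 2), (e ^+ 2); split=> //.
- exact: exprn_gt0.
- split=> y; rewrite bw; first exact: exprn_ge0.
  by rewrite ltr_pXn2r ?nnegrE ?normr_ge0 ?(ltW e0)// distrC.
Qed.

Lemma near_char_norm_ge z a : A a -> gval z a != 0 ->
  near_char z [set y | `|gval z a| / 2 <= `|a y|].
Proof.
move=> Aa za; have e0 : 0 < `|gval z a| / 2 by rewrite divr_gt0// normr_gt0.
have /cvgrPdist_lt/(_ _ e0) := near_char_cvg (z := z) Aa.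
apply: filterS => y /= h.
have := ler_normD (gval z a - a y) (a y); rewrite subrK => h2.
rewrite -(lerD2l (`|gval z a| / 2)) -splitr (le_trans h2)// lerD2r.
exact: ltW.
Qed.

Lemma gval_le z a (M : C) : A a -> 0 < M -> (forall y, `|a y| <= M) ->
  `|gval z a| <= M.
Proof.
move=> Aa M0 aM; rewrite real_leNgt ?normr_real ?(gtr0_real M0)//.
apply/negP => zM.
have e0 : 0 < `|gval z a| - M by rewrite subr_gt0.
have /cvgrPdist_lt/(_ _ e0) := near_char_cvg (z := z) Aa.
move=> /filter_ex[y /= h].
have := ler_normD (gval z a - a y) (a y); rewrite subrK.
by move=> /le_lt_trans /(_ (ltr_leD h (aM y))); rewrite subrK ltxx.
Qed.

(** Since [a] converges to z(a) along the filter of [z], a cluster point of [g] must give the same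
    value. It is applied with [p] for [g] to obtain the anchor, and with the identity to recognise
    points of [Y]. *)
Lemma near_char_cluster z (T : topologicalType) (g : Y -> T) (t : T)
    (f : T -> C) a :
  cluster (g @ near_char z) t -> continuous f -> A a -> a = f \o g ->
  gval z a = f t.
Proof.
move=> gt cf Aa E; apply: (@norm_hausdorff C C) => U V Uz Vt.
have aU : near_char z (a @^-1` U) by exact: near_char_cvg.
have [_ [[y Uy <-] fy]] := gt (g @` (a @^-1` U)) (f @^-1` V)
  (filterS (@preimage_image _ _ g _) aU) (cf _ _ Vt).
by exists (a y); split=> //; rewrite E.
Qed.

(** Take [a] with z(a) nonzero. A level set of [a] belongs to the filter of [z] and lies over a
    compact set, so [p] has a cluster point along this filter. *)
Lemma spectrum_anchor : exists q : Z -> X, forall z (f : X -> C), C0 f ->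
  gval z (f \o p) = f (q z).
Proof.
suff /choice[q qP] : forall z, exists x, forall f : X -> C, C0 f ->
    gval z (f \o p) = f x by exists q.
move=> z; have [a Aa za] := gval_neq0 z.
have e0 : 0 < `|gval z a| / 2 by rewrite divr_gt0// normr_gt0.
have [K cK aK] := fa_vanish fA Aa e0.
have pK : (p @ near_char z) K.
  by apply: filterS (near_char_norm_ge Aa za) => y /aK.
have [x [Kx xp]] := cK _ _ pK.
exists x => f [cf f0].
exact: (near_char_cluster xp cf (fa_pullback fA (conj cf f0))).
Qed.

(** Along an ultrafilter of characters, the values at each element of [A] stay in a disc and hence
    converge. The limits form a *-homomorphism, and the bound [e] at [a] survives in the limit and
    keeps it from being zero. *)
Lemma spectrum_norm_ge_compact a (e : C) : A a -> 0 < e ->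
  compact [set z : Z | e <= `|gval z a|].
Proof.
move=> Aa e0; rewrite compact_ultra => U UU aU.
have lim b : A b -> exists l : C, (fun z : Z => gval z b) @ U --> l.
  move=> Ab; have [M M0 bM] := fa_bounded fA Ab.
  have bU : U [set z : Z | `|gval z b| <= M].
    by apply: filterS (@filterT _ U _) => z _; exact: (gval_le _ Ab M0 bM).
  have [l [_ lc]] := @compact_disc R M ((fun z : Z => gval z b) @ U) _ bU.
  exists l => V Vl.
  have [//|nV] := in_ultra_setVsetC ((fun z : Z => gval z b) @^-1` V) UU.
  have [_ [[z nVz <-] Vz]] := lc
    ((fun z : Z => gval z b) @` (~` ((fun z : Z => gval z b) @^-1` V))) V
    (filterS (@preimage_image _ _ (fun z : Z => gval z b) _) nV) Vl.
  by [].
have [l lU] : exists l : (Y -> C) -> C, forall b, A b ->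
    (fun z : Z => gval z b) @ U --> l b.
  suff /choice[l lU] : forall b, exists l : C, A b -> (fun z : Z => gval z b) @ U --> l.
    by exists l.
  move=> b.
  have [/lim[l bl]|nAb] := pselect (A b); first by exists l.
  by exists 0.
have ela : e <= `|l a|.
  apply: (closed_cvg (fun w : C => e <= `|w|) _ aU _ (lU _ Aa)).
  by apply: (@closed_norm_ge _ _ id) => //; [move=> w; exact: cvg_id|rewrite gtr0_real].
have uniq (v : Z -> C) (l1 l2 : C) : v @ U --> l1 -> v @ U --> l2 -> l1 = l2.
  exact: (@cvg_unique _ (@norm_hausdorff C C)).
have [z zl] : exists z, forall b, A b -> gval z b = l b.
  apply: spectrum_of.
  - move=> b b' Ab Ab' Abb'; apply: (uniq _ _ _ (lU _ Abb')).
    under eq_fun do rewrite gval_add//.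
    by apply: cvgD; exact: lU.
  - move=> k b Ab Akb; apply: (uniq _ _ _ (lU _ Akb)).
    under eq_fun do rewrite gval_scale//.
    by apply: cvgM; [exact: cvg_cst|exact: lU].
  - move=> b b' Ab Ab' Abb'; apply: (uniq _ _ _ (lU _ Abb')).
    under eq_fun do rewrite gval_mul//.
    by apply: cvgM; exact: lU.
  - move=> b Ab Acb; apply: (uniq _ _ _ (lU _ Acb)).
    under eq_fun do rewrite gval_conj//.
    by apply: cvg_conj; exact: lU.
  - by exists a => //; rewrite -normr_gt0 (lt_le_trans e0).
exists z; split; first by rewrite /= zl.
by apply: cvg_spectrum => b Ab; rewrite zl//; exact: lU.
Qed.

End fibre_algebra_spectrum.

(** * The spectrum as a fibrewise compactification *)

Section fibrewise_compactification_spectrum.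
Variables (R : realType) (X Y : topologicalType) (p : Y -> X).
Local Notation C := (cplx R).
Variable A : set (Y -> C).
Hypothesis fA : fibre_algebra p A.
Hypotheses (lcX : locally_compact [set: X]) (hX : hausdorff_space X).
Hypotheses (lcY : locally_compact [set: Y]) (hY : hausdorff_space Y).
Local Notation Z := (gelfand_spectrum A).
Implicit Types (a b : Y -> C) (z : Z).

Lemma gelfand_maps_exist : exists (phi : Y -> Z) (q : Z -> X),
  gelfand_maps p phi q.
Proof.
have /choice[phi phiE] : forall y, exists z, forall a, A a -> gval z a = a y.
  move=> y; apply: spectrum_of => //.
  have [f [f0 fy _] _] := C0_urysohn R lcY hY openT (I : [set: Y] y).
  by exists f; [exact: (fa_C0 fA)|rewrite fy oner_neq0].
have [q qE] := spectrum_anchor fA.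
exists phi, q; split=> [y a|z f a f0 aE].
  by rewrite -gvalE phiE//; exact: gelemP.
by rewrite -gvalE aE qE.
Qed.

Variables (phi : Y -> Z) (q : Z -> X).
Hypothesis gm : gelfand_maps p phi q.

Lemma gval_phi y a : A a -> gval (phi y) a = a y.
Proof. by move=> Aa; rewrite (gval_elem _ Aa) (gm_eval gm). Qed.

Lemma gval_q z (f : X -> C) : C0 f -> gval z (f \o p) = f (q z).
Proof.
move=> f0; rewrite (gval_elem _ (fa_pullback fA f0)).
exact: (gm_dual gm).
Qed.

Lemma C0_separates (T : topologicalType) (s t : T) :
  locally_compact [set: T] -> hausdorff_space T ->
  (forall f : T -> C, C0 f -> f s = f t) -> s = t.
Proof.
move=> lcT hT st; apply: contrapT => nst.
have oU : open (~` [set t]).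
  by rewrite openC; apply: accessible_closed_set1; exact: hausdorff_accessible.
have [f [f0 fs _] [K [_ KU] fK]] := C0_urysohn R lcT hT oU (nst : (~` [set t]) s).
have ft : f t != 0 by rewrite -(st f f0) fs oner_neq0.
by apply: (KU _ (fK _ ft)).
Qed.

Lemma q_phi y : q (phi y) = p y.
Proof.
apply: (C0_separates lcX hX) => f f0.
by rewrite -gval_q// gval_phi//; exact: (fa_pullback fA).
Qed.

Lemma continuous_q : continuous q.
Proof.
move=> z U; rewrite nbhsE => -[V [oV Vqz] VU].
have [f [f0 fz _] [K [_ KV] fK]] := C0_urysohn R lcX hX oV Vqz.
have Af := fa_pullback fA f0.
have oN := open_norm_gt (continuous_gval Af) (2^-1 : C).
have : nbhs z [set w | 2^-1 < `|gval w (f \o p)|].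
  by apply: open_nbhs_nbhs; split=> //=; rewrite gval_q// fz normr1 invf_lt1// ltr1n.
apply: filterS => w /=; rewrite gval_q// => fw; apply/VU/KV/fK.
by rewrite -normr_gt0 (lt_trans _ fw)// invr_gt0.
Qed.

Lemma cvg_phi z : phi @ near_char z --> z.
Proof.
have FF := near_char_filter fA z.
apply: cvg_spectrum => a Aa; under eq_fun do rewrite gval_phi//.
exact: (near_char_cvg fA Aa).
Qed.

Lemma dense_phi : dense (range phi).
Proof.
move=> U [z Uz] oU.
have FF := near_char_filter fA z.
have Uphi : near_char z (phi @^-1` U).
  by apply: (cvg_phi (z := z)); apply: open_nbhs_nbhs.
by have [y Uy] := filter_ex Uphi; exists (phi y); split=> //; exists y.
Qed.

Lemma continuous_phi : continuous phi.
Proof.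
move=> y; apply: cvg_spectrum => a Aa; rewrite gval_phi//.
by under eq_fun do rewrite gval_phi//; exact: (fa_continuous fA Aa).
Qed.

(** A level set of [a] is compact and belongs to the filter of [z], which therefore clusters at some
    [y]; then [z] is evaluation at [y]. This makes the image of [phi] open. *)
Lemma gval_C0_point z a : C0 a -> gval z a != 0 -> exists y, z = phi y.
Proof.
move=> a0 za; have Aa := fa_C0 fA a0.
have FF := near_char_filter fA z.
have e0 : 0 < `|gval z a| / 2 by rewrite divr_gt0// normr_gt0.
have [y [_ yc]] := a0.2 _ e0 (id @ near_char z) _ (near_char_norm_ge fA Aa za).
exists y; apply: gval_inj => b Ab; rewrite gval_phi//.
exact: (near_char_cluster fA yc (fa_continuous fA Ab) Ab).
Qed.

Lemma open_embedding_phi : open_embedding_on [set: Y] phi.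
Proof.
split.
- by apply: continuous_subspaceT; exact: continuous_phi.
- move=> y y' _ _ yy'; apply: (C0_separates lcY hY) => f f0.
  by have Af := fa_C0 fA f0; rewrite -!gval_phi// yy'.
- move=> W oW _; rewrite openE => _ [y Wy <-].
  have [f [f0 fy _] [K [_ KW] fK]] := C0_urysohn R lcY hY oW Wy.
  have Af := fa_C0 fA f0.
  have oN := open_norm_gt (continuous_gval Af) (2^-1 : C).
  have : nbhs (phi y) [set w | 2^-1 < `|gval w f|].
    by apply: open_nbhs_nbhs; split=> //=; rewrite gval_phi// fy normr1 invf_lt1// ltr1n.
  apply: filterS => w /= fw.
  have w0 : gval w f != 0 by rewrite -normr_gt0 (lt_trans _ fw)// invr_gt0.
  have [y' wy'] := gval_C0_point f0 w0.
  by exists y' => //; apply/KW/fK; rewrite -gval_phi// -wy'.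
Qed.

Lemma proper_q : proper_map q.
Proof.
move=> K cK; rewrite compact_ultra => U UU KU.
have qU : (q @ U) K by exact: KU.
have [x [Kx xq]] := cK (q @ U) _ qU.
have [f [f0 fx _] _] := C0_urysohn R lcX hX openT (I : [set: X] x).
have Af := fa_pullback fA f0.
have h0 : (0 : C) < 2^-1 by rewrite invr_gt0.
(* The compact set [D] belongs to the ultrafilter: otherwise its complement would, although |f|
   exceeds 1/2 near the cluster point [x], where f is 1. *)
pose D := [set z : Z | 2^-1 <= `|gval z (f \o p)|].
have DU : U D.
  have [//|nD] := in_ultra_setVsetC D UU.
  have Vx : nbhs x [set x' | 2^-1 < `|f x'|].
    apply: open_nbhs_nbhs; split; first by apply: open_norm_gt; case: f0.
    by rewrite /= fx normr1 invf_lt1// ltr1n.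
  have [_ [[z nDz <-] /=]] := xq (q @` (~` D)) _
    (filterS (@preimage_image _ _ q _) nD) Vx.
  by rewrite -gval_q// => /ltW.
have cD : compact D by exact: (spectrum_norm_ge_compact fA Af h0).
rewrite compact_ultra in cD.
have [z [_ zU]] := cD U UU DU.
exists z; split=> //.
apply: (closed_cvg K (compact_closed hX cK) qU).
by apply: (cvg_comp _ _ zU); exact: continuous_q.
Qed.

Lemma spectrum_fibrewise_compactification : fibrewise_compactification p phi q.
Proof.
split.
- move=> z _; rewrite withinET.
  have [f [f0 fx _] _] := C0_urysohn R lcX hX openT (I : [set: X] (q z)).
  have Af := fa_pullback fA f0.
  have h0 : (0 : C) < 2^-1 by rewrite invr_gt0.
  exists [set w : Z | 2^-1 <= `|gval w (f \o p)|].
    have oN := open_norm_gt (continuous_gval Af) (2^-1 : C).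
    apply: (@filterS _ _ _ [set w | 2^-1 < `|gval w (f \o p)|]) => [w /ltW//|].
    by apply: open_nbhs_nbhs; split=> //=; rewrite gval_q// fx normr1 invf_lt1// ltr1n.
  split; first exact: (spectrum_norm_ge_compact fA Af h0).
  by apply: closed_norm_ge; [exact: continuous_gval|rewrite gtr0_real].
- exact: hausdorff_spectrum.
- exact: continuous_q.
- exact: proper_q.
- exact: open_embedding_phi.
- exact: dense_phi.
- exact: q_phi.
Qed.

End fibrewise_compactification_spectrum.

(** * Extension of the action *)

Lemma within_continuous_cvg (S T : topologicalType) (D : set S) (f : S -> T)
    (I : Type) (F : set_system I) (w : I -> S) (x : S) : Filter F ->
  {within D, continuous f} -> D x -> w @ F --> x -> (\forall i \near F, D (w i)) ->
  (f \o w) @ F --> f x.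
Proof.
move=> FF /subspace_continuousP cf Dx wx wD U /(cf x Dx) /wx.
by apply: filterS2 wD => i Dwi; exact.
Qed.

Lemma cvg_within_filter (S : Type) (T : Type) (F : set_system S) (D : set S)
    (f : S -> T) (H : set_system T) : Filter F ->
  f @ F --> H -> f @ within D F --> H.
Proof. by move=> FF; apply: cvg_trans; exact: (cvg_app f (cvg_within D)). Qed.

(** * Topology of the unit space *)

Section unit_space.
Variables (G X : topologicalType) (Gd : groupoid G X).
Hypothesis lcG : locally_compact_groupoid Gd.

Lemma hausdorff_units : hausdorff_space X.
Proof.
move=> x y xy; rewrite -(grng_unit Gd x) -(grng_unit Gd y); congr (grng Gd _).
apply: (lcg_hausdorff lcG) => U V /(lcg_unit_continuous lcG) Ux.
move=> /(lcg_unit_continuous lcG) Vy.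
by have [t [Ut Vt]] := xy _ _ Ux Vy; exists (gunit Gd t).
Qed.

(** The range map is continuous and open, so it carries a compact neighbourhood of the unit at [x]
    to a compact neighbourhood of [x]. *)
Lemma locally_compact_units : locally_compact [set: X].
Proof.
move=> x _; rewrite withinET.
have [K] := lcg_locally_compact lcG (x := gunit Gd x) I.
rewrite withinET => Kx [cK _].
have crK : compact (grng Gd @` K).
  apply: continuous_compact => //; apply: continuous_subspaceT.
  exact: (lcg_rng_continuous lcG).
exists (grng Gd @` K).
  have oK := lcg_rng_open lcG (open_interior K).
  apply: (@filterS _ _ _ (grng Gd @` K°)).
    by apply: image_subset; exact: interior_subset.
  by apply: open_nbhs_nbhs; split=> //; exists (gunit Gd x) => //; exact: grng_unit.
by split=> //; exact: (compact_closed hausdorff_units).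
Qed.

Lemma src_near (g : G) (x : X) (V : set G) : nbhs g V -> gsrc Gd g = x ->
  \forall x' \near x, exists2 h, V h & gsrc Gd h = x'.
Proof.
move=> gV <-; have oV := lcg_src_open lcG (open_interior V).
apply: (@filterS _ _ _ (gsrc Gd @` V°)).
  by move=> _ [h Vh <-]; exists h => //; exact: interior_subset.
by apply: open_nbhs_nbhs; split=> //; exists g.
Qed.

End unit_space.

Section action_extension.
Variables (R : realType) (G X Y : topologicalType) (Gd : groupoid G X).
Variables (p : Y -> X) (act : G -> Y -> Y).
Local Notation C := (cplx R).
Local Notation s := (gsrc Gd).
Local Notation r := (grng Gd).
Variable A : set (Y -> C).
Local Notation Z := (gelfand_spectrum A).
Hypotheses (lcG : locally_compact_groupoid Gd) (gspY : left_gspace Gd p act).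
Hypothesis fA : fibre_algebra p A.

(** All that the extension uses of étaleness. The set [U] and the cut-off [f] do not depend on [a],
    and [b] serves for every [h] in [U] at once. *)
Definition action_stable := forall g : G, exists U (f : X -> C),
  [/\ open U, U g, C0 f, f (s g) = 1 & forall a, A a -> exists2 b, A b &
    forall h y, U h -> s h = p y -> b y = f (p y) * a (act h y)].

Hypothesis stA : action_stable.
Variables (phi : Y -> Z) (q : Z -> X).
Hypothesis gm : gelfand_maps p phi q.

Let hX := hausdorff_units lcG.
Let lcX := locally_compact_units lcG.
Let cq := continuous_q fA lcX hX gm.
Let qphi := q_phi fA lcX hX gm.

Definition near_pair (g : G) (z : Z) : set_system (G * Y) :=
  within [set hy | s hy.1 = p hy.2] (filter_prod (nbhs g) (near_char z)).

Definition near_triple (g2 g1 : G) (z : Z) : set_system (G * (G * Y)) :=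
  within [set t | s t.2.1 = p t.2.2 /\ s t.1 = r t.2.1]
    (filter_prod (nbhs g2) (filter_prod (nbhs g1) (near_char z))).

Lemma cvg_p (z : Z) : p @ near_char z --> q z.
Proof.
have FF := near_char_filter fA z.
rewrite (_ : p = q \o phi); last by apply/funext => y /=; rewrite qphi.
exact: (cvg_comp _ _ (cvg_phi fA gm (z := z)) (@cq z)).
Qed.

(** As y tends to [z], p(y) tends to q(z) = s(g); since [s] is open, p(y) is then the source of an
    element close to [g]. *)
Lemma near_pair_filter g z : s g = q z -> ProperFilter (near_pair g z).
Proof.
have FF := near_char_filter fA z.
move=> gz; rewrite /near_pair; apply: Build_ProperFilter_ex => S [[V N] /= [gV zN] VN].
have : near_char z (p @^-1` [set x' | exists2 h, V h & s h = x']).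
  by apply: cvg_p; exact: (src_near lcG gV gz).
move=> /(filterI zN)/filter_ex[y [Ny [h Vh hy]]].
by exists (h, y); exact: VN.
Qed.

Lemma near_triple_filter g2 g1 z : s g1 = q z -> s g2 = r g1 ->
  ProperFilter (near_triple g2 g1 z).
Proof.
have FF := near_char_filter fA z.
move=> gz gg; rewrite /near_triple; apply: Build_ProperFilter_ex => S.
move=> [[V2 W] /= [gV2 [[V1 N] /= [gV1 zN] WN]] VN].
(* Openness of [s] is used twice: first to keep h1 among the elements whose range is a source from
   [V2], then to match s(h1) with p(y). *)
have V21 : nbhs g1 (r @^-1` [set x' | exists2 h, V2 h & s h = x']).
  by apply: (lcg_rng_continuous lcG); exact: (src_near lcG gV2 gg).
have : near_char z (p @^-1` [set x' | exists2 h,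
    (V1 `&` r @^-1` [set x' | exists2 h, V2 h & s h = x']) h & s h = x']).
  by apply: cvg_p; exact: (src_near lcG (filterI gV1 V21) gz).
move=> /(filterI zN)/filter_ex[y [Ny [h1 [V1h [h2 V2h h21]] hy]]].
exists (h2, (h1, y)); apply: VN => //=; split=> //=.
exact: (WN (h1, y)).
Qed.

Lemma near_pair_maps g z : s g = q z ->
  [/\ fst @ near_pair g z --> g, (phi \o snd) @ near_pair g z --> z &
      \forall hy \near near_pair g z, s hy.1 = p hy.2].
Proof.
have FF := near_char_filter fA z.
move=> gz; split.
- by apply: cvg_within_filter; exact: cvg_fst.
- apply: cvg_within_filter.
  exact: (cvg_comp _ _ cvg_snd (cvg_phi fA gm (z := z))).
- exact: withinT.
Qed.

(** At [y] itself the base function a + c is 0. Hence a limit along this filter can only be the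
    value at (g, y), which shows that the extension agrees with [act]. *)
Lemma near_pair_point g y S : near_pair g (phi y) S -> s g = p y -> S (g, y).
Proof.
move=> [[V N] /= [gV yN] VN] gy; apply: VN => //; split=> /=.
  exact: nbhs_singleton.
have [a [c [d [Aa ya c0 d0 [ac aN]]]]] := yN.
by apply: aN; rewrite -(gval_phi gm _ Aa) ya addNr.
Qed.

(** Near (g, z) the cut-off does not vanish and a(h y) = b(y) / f(p y); numerator and denominator
    converge to their values at [z]. *)
Lemma cvg_act g z U (f : X -> C) a b : s g = q z -> open U -> U g ->
  C0 f -> f (q z) != 0 -> A b ->
  (forall h y, U h -> s h = p y -> b y = f (p y) * a (act h y)) ->
  (fun hy => a (act hy.1 hy.2)) @ near_pair g z --> gval z b / f (q z).
Proof.
move=> gz oU Ug f0 fz Ab ab; have FF := near_pair_filter gz.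
have [cg cz gp] := near_pair_maps gz.
have cf : (fun hy => f (p hy.2)) @ near_pair g z --> f (q z).
  rewrite (_ : (fun hy => _) = (f \o q) \o (phi \o snd)); last first.
    by apply/funext => hy /=; rewrite qphi.
  apply: (cvg_comp _ _ cz); apply: (cvg_comp _ _ (@cq z)).
  by case: f0 => cf _; exact: cf.
have cb : (fun hy => b hy.2) @ near_pair g z --> gval z b.
  rewrite (_ : (fun hy => _) = (fun w => gval w b) \o (phi \o snd)); last first.
    by apply/funext => hy /=; rewrite (gval_phi gm).
  exact: (cvg_comp _ _ cz (continuous_gval Ab (x := z))).
apply: cvg_trans (cvgM cb (cvgV fz cf)).
apply: near_eq_cvg.
have gU : \forall hy \near near_pair g z, U hy.1.
  by apply: cg; exact: open_nbhs_nbhs.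
have fn : \forall hy \near near_pair g z, f (p hy.2) != 0.
  exact: (cvgr_neq0 _ cf).
near=> hy.
rewrite /= (ab hy.1 hy.2); [|by near: hy|by near: hy].
rewrite mulrAC mulfV ?mul1r//; near: hy.
exact: fn.
Unshelve. all: by end_near. Qed.

Let continuous_comp_rng (f : X -> C) :
  continuous f -> continuous (fun g => f (r g)).
Proof.
move=> cf g; exact: (continuous_comp (@lcg_rng_continuous _ _ _ lcG g) (@cf (r g))).
Qed.

(** The limits respect the operations. They are not all zero: for f' in C_0(X) with f'(r g) = 1, the
    values of f' o p at h y are f'(r h), which tend to 1. *)
Lemma action_limit g z : s g = q z -> exists w : Z, forall a, A a ->
  (fun hy => a (act hy.1 hy.2)) @ near_pair g z --> gval w a.
Proof.
move=> gz; have FF := near_pair_filter gz.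
have [cg cz gp] := near_pair_maps gz.
have [U [f [oU Ug f0 fg st]]] := stA g.
have /choice[l lE] : forall a, exists l : C, A a ->
    (fun hy => a (act hy.1 hy.2)) @ near_pair g z --> l.
  move=> a; have [/st[b Ab ab]|nAa] := pselect (A a); last by exists 0.
  exists (gval z b / f (q z)) => _; apply: (cvg_act gz oU) => //.
  by rewrite -gz fg oner_neq0.
have uniq (v : G * Y -> C) (l1 l2 : C) : v @ near_pair g z --> l1 ->
    v @ near_pair g z --> l2 -> l1 = l2.
  exact: (@cvg_unique _ (@norm_hausdorff C C)).
suff [w wE] : exists w : Z, forall a, A a -> gval w a = l a.
  by exists w => a Aa; rewrite wE//; exact: lE.
apply: spectrum_of.
- move=> a b Aa Ab Aab; apply: (uniq _ _ _ (lE _ Aab)).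
  exact: (cvgD (lE _ Aa) (lE _ Ab)).
- move=> k a Aa Aka; apply: (uniq _ _ _ (lE _ Aka)).
  by apply: cvgM; [exact: cvg_cst|exact: lE].
- move=> a b Aa Ab Aab; apply: (uniq _ _ _ (lE _ Aab)).
  exact: (cvgM (lE _ Aa) (lE _ Ab)).
- move=> a Aa Aca; apply: (uniq _ _ _ (lE _ Aca)).
  by apply: cvg_conj; exact: lE.
- have [f' [f'0 f'g _] _] := C0_urysohn R lcX hX openT (I : [set: X] (r g)).
  have Af := fa_pullback fA f'0.
  exists (f' \o p) => //.
  suff -> : l (f' \o p) = 1 by exact: oner_neq0.
  apply: (uniq _ _ _ (lE _ Af)).
  have h : (fun hy : G * Y => f' (r hy.1)) @ near_pair g z --> f' (r g).
    exact: (cvg_comp _ _ cg (continuous_comp_rng f'0.1 (x := g))).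
  rewrite -f'g.
  apply: cvg_trans h; apply: near_eq_cvg.
  by apply: filterS gp => hy hyp /=; rewrite (gsp_anchor gspY).
Qed.

Variable actZ : G -> Z -> Z.
Hypothesis actZ_cvg : forall g z, s g = q z -> forall a, A a ->
  (fun hy => a (act hy.1 hy.2)) @ near_pair g z --> gval (actZ g z) a.

Let uniq (I : Type) (F : set_system I) (v : I -> C) (l1 l2 : C) :
  ProperFilter F -> v @ F --> l1 -> v @ F --> l2 -> l1 = l2.
Proof. by move=> FF; exact: (@cvg_unique _ (@norm_hausdorff C C)). Qed.

(** The right-hand side no longer involves a limit or [g], and the same [U], [f], [b] serve for all
    nearby pairs. Joint continuity of the extended action follows. *)
Lemma extended_act_formula g z U (f : X -> C) a b : s g = q z -> open U ->
  U g -> C0 f -> f (q z) != 0 -> A a -> A b ->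
  (forall h y, U h -> s h = p y -> b y = f (p y) * a (act h y)) ->
  gval (actZ g z) a = gval z b / f (q z).
Proof.
move=> gz oU Ug f0 fz Aa Ab ab.
apply: (uniq (near_pair_filter gz) (actZ_cvg gz Aa)).
exact: (cvg_act gz oU).
Qed.

Lemma extended_act_phi g y : s g = p y -> actZ g (phi y) = phi (act g y).
Proof.
move=> gy; have gz : s g = q (phi y) by rewrite qphi.
have FF := near_pair_filter gz.
apply: gval_inj => a Aa; rewrite (gval_phi gm _ Aa).
apply: (@norm_hausdorff C C) => U V /(actZ_cvg gz Aa) /near_pair_point /(_ gy) Uy.
by move=> /nbhs_singleton Vy; exists (a (act g y)).
Qed.

Lemma extended_act_anchor g z : s g = q z -> q (actZ g z) = r g.
Proof.
move=> gz; have FF := near_pair_filter gz.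
have [cg cz gp] := near_pair_maps gz.
apply: (C0_separates (R := R) lcX hX) => f f0.
have Af := fa_pullback fA f0.
rewrite -(gval_q fA gm _ f0); apply: (uniq FF (actZ_cvg gz Af)).
have h : (fun hy : G * Y => f (r hy.1)) @ near_pair g z --> f (r g).
  exact: (cvg_comp _ _ cg (continuous_comp_rng f0.1 (x := g))).
apply: cvg_trans h; apply: near_eq_cvg.
by apply: filterS gp => hy hyp /=; rewrite (gsp_anchor gspY).
Qed.

Lemma extended_act_continuous :
  {within [set gz : G * Z | s gz.1 = q gz.2],
    continuous (fun gz : G * Z => actZ gz.1 gz.2)}.
Proof.
apply/subspace_continuousP => -[g z] /= gz.
apply: cvg_spectrum => a Aa.
have [U [f [oU Ug f0 fg st]]] := stA g.
have [b Ab ab] := st a Aa.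
have fz : f (q z) != 0 by rewrite -gz fg oner_neq0.
rewrite (extended_act_formula gz oU Ug f0 fz Aa Ab ab).
set F := within _ _.
have cw : snd @ F --> z by apply: cvg_within_filter; exact: cvg_snd.
have ch : fst @ F --> g by apply: cvg_within_filter; exact: cvg_fst.
have cfq : {for z, continuous (fun w => f (q w))}.
  by apply: continuous_comp; [exact: cq|case: f0 => cf _; exact: cf].
have cf : (fun hw : G * Z => f (q hw.2)) @ F --> f (q z).
  exact: (cvg_comp _ _ cw cfq).
have cb : (fun hw : G * Z => gval hw.2 b) @ F --> gval z b.
  exact: (cvg_comp _ _ cw (continuous_gval Ab (x := z))).
apply: cvg_trans (cvgM cb (cvgV fz cf)).
apply: near_eq_cvg.
have gU : \forall hw \near F, U hw.1.
  by apply: ch; exact: open_nbhs_nbhs.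
have fn : \forall hw \near F, f (q hw.2) != 0.
  exact: (cvgr_neq0 _ cf).
have hD : \forall hw \near F, s hw.1 = q hw.2 by exact: withinT.
near=> hw; rewrite /= (extended_act_formula (U := U) (f := f) (b := b))//.
- by near: hw.
- by near: hw.
- by near: hw; exact: fn.
Unshelve. all: by end_near. Qed.

Lemma extended_act_cvg (I : Type) (F : set_system I) (u : I -> G) (v : I -> Z)
    g z (FF : Filter F) : s g = q z -> u @ F --> g -> v @ F --> z ->
  (\forall i \near F, s (u i) = q (v i)) ->
  (fun i => actZ (u i) (v i)) @ F --> actZ g z.
Proof.
move=> gz ug vz uv.
apply: (within_continuous_cvg (x := (g, z)) (w := fun i => (u i, v i))
  FF extended_act_continuous gz) => //.
exact: (cvg_pair ug vz).
Qed.

Lemma extended_act_unit z : actZ (gunit Gd (q z)) z = z.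
Proof.
have FF := near_char_filter fA z.
apply: (@cvg_unique _ (@hausdorff_spectrum R Y A) (phi @ near_char z));
  last exact: (cvg_phi fA gm (z := z)).
have h : (fun y => actZ (gunit Gd (p y)) (phi y)) @ near_char z
    --> actZ (gunit Gd (q z)) z.
  apply: extended_act_cvg.
  - exact: gsrc_unit.
  - exact: (cvg_comp _ _ (cvg_p (z := z)) (@lcg_unit_continuous _ _ _ lcG (q z))).
  - exact: (cvg_phi fA gm (z := z)).
  - by apply: nearW => y; rewrite gsrc_unit qphi.
rewrite (_ : phi = fun y => actZ (gunit Gd (p y)) (phi y))//.
apply/funext => y.
by rewrite extended_act_phi ?gsrc_unit// (gsp_unit gspY).
Qed.

Lemma near_triple_maps g2 g1 z : s g1 = q z -> s g2 = r g1 ->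
  [/\ fst @ near_triple g2 g1 z --> g2,
      (fun t => t.2.1) @ near_triple g2 g1 z --> g1,
      (fun t => phi t.2.2) @ near_triple g2 g1 z --> z &
      \forall t \near near_triple g2 g1 z,
        s t.2.1 = p t.2.2 /\ s t.1 = r t.2.1].
Proof.
have FF := near_char_filter fA z.
move=> gz gg; split.
- by apply: cvg_within_filter; exact: cvg_fst.
- by apply: cvg_within_filter; exact: (cvg_comp _ _ cvg_snd cvg_fst).
- apply: cvg_within_filter.
  exact: (cvg_comp _ _ cvg_snd (cvg_comp _ _ cvg_snd (cvg_phi fA gm (z := z)))).
- exact: withinT.
Qed.

(** By joint continuity both sides are limits along [near_triple], where they agree because [act] is
    an action on [Y]. *)
Lemma extended_act_mul g2 g1 z : s g1 = q z -> s g2 = r g1 ->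
  actZ (gmul Gd g2 g1) z = actZ g2 (actZ g1 z).
Proof.
move=> gz gg; have FF := near_triple_filter gz gg.
have [c2 c1 cz st] := near_triple_maps gz gg.
have cm : (fun t => gmul Gd t.1 t.2.1) @ near_triple g2 g1 z --> gmul Gd g2 g1.
  apply: (within_continuous_cvg (x := (g2, g1)) (w := fun t => (t.1, t.2.1))
    _ (lcg_mul_continuous lcG) gg).
    exact: (cvg_pair c2 c1).
  by apply: filterS st => t [].
have L : (fun t => actZ (gmul Gd t.1 t.2.1) (phi t.2.2)) @ near_triple g2 g1 z
    --> actZ (gmul Gd g2 g1) z.
  apply: extended_act_cvg => //; first by rewrite gsrc_mul.
  by apply: filterS st => t [t1 t2]; rewrite gsrc_mul// t1 qphi.
have R1 : (fun t => actZ t.2.1 (phi t.2.2)) @ near_triple g2 g1 z --> actZ g1 z.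
  apply: extended_act_cvg => //.
  by apply: filterS st => t [t1 t2]; rewrite t1 qphi.
have R2 : (fun t => actZ t.1 (actZ t.2.1 (phi t.2.2))) @ near_triple g2 g1 z
    --> actZ g2 (actZ g1 z).
  apply: extended_act_cvg => //; first by rewrite extended_act_anchor.
  apply: filterS st => t [t1 t2].
  by rewrite extended_act_anchor ?t2// t1 qphi.
apply: (@cvg_unique _ (@hausdorff_spectrum R Y A) _ _ _ _ L).
apply: cvg_trans R2; apply: near_eq_cvg.
apply: filterS st => t [t1 t2].
have t12 : s t.1 = p (act t.2.1 t.2.2) by rewrite (gsp_anchor gspY).
have tm : s (gmul Gd t.1 t.2.1) = p t.2.2 by rewrite gsrc_mul.
by rewrite /= (extended_act_phi t1) (extended_act_phi t12) (extended_act_phi tm)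
  (gsp_mul gspY).
Qed.

End action_extension.

Lemma gelfand_action_extends_uniquely (R : realType) (G X Y : topologicalType)
    (Gd : groupoid G X) (p : Y -> X) (act : G -> Y -> Y) (A : set (Y -> cplx R)) :
  locally_compact_groupoid Gd -> left_gspace Gd p act -> fibre_algebra p A ->
  action_stable Gd p act A -> action_extends_uniquely Gd p act A.
Proof.
move=> lcG gspY fA stA.
have hX := hausdorff_units lcG.
have lcX := locally_compact_units lcG.
have hY := gsp_hausdorff gspY.
have lcY := gsp_locally_compact gspY.
split; first exact: (gelfand_maps_exist fA lcY hY).
move=> phi q gm.
have fc := spectrum_fibrewise_compactification fA lcX hX lcY hY gm.
split=> //.
(* At pairs that are not composable the chosen value is the default [z]. *)
have /choice[actZ actZE] : forall gz : G * gelfand_spectrum A,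
    exists w : gelfand_spectrum A, gsrc Gd gz.1 = q gz.2 -> forall a, A a ->
    (fun hy => a (act hy.1 hy.2)) @ near_pair Gd p gz.1 gz.2 --> gval w a.
  move=> [g z]; have [gz|ngz] := pselect (gsrc Gd g = q z); last by exists z.
  by have [w wE] := action_limit lcG gspY fA stA gm gz; exists w.
pose aZ g z := actZ (g, z).
have aZ_cvg g z : gsrc Gd g = q z -> forall a, A a ->
    (fun hy => a (act hy.1 hy.2)) @ near_pair Gd p g z --> gval (aZ g z) a.
  exact: (actZE (g, z)).
exists aZ.
  split; last first.
    move=> g y gy.
    by rewrite (extended_act_phi lcG fA gm aZ_cvg).
  split.
  - exact: (fc_locally_compact fc).
  - exact: (fc_hausdorff fc).
  - exact: (fc_continuous fc).
  - exact: (extended_act_continuous lcG fA stA gm aZ_cvg).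
  - exact: (extended_act_anchor lcG gspY fA gm aZ_cvg).
  - exact: (extended_act_unit lcG gspY fA stA gm aZ_cvg).
  - exact: (extended_act_mul lcG gspY fA stA gm aZ_cvg).
move=> aZ' [gZ' aZ'phi] g z gz.
have FF := near_pair_filter lcG fA gm gz.
have [cg cz gp] := near_pair_maps fA gm gz.
have qphi := q_phi fA lcX hX gm.
have D (hy : G * Y) : gsrc Gd hy.1 = p hy.2 ->
  gsrc Gd hy.1 = q (phi hy.2) by rewrite qphi.
(* Every continuous extension has the value at (g, z) that is the limit of phi(h y), an expression
   in which the extension does not occur. *)
have lim (bZ : G -> gelfand_spectrum A -> gelfand_spectrum A) :
    {within [set gz : G * gelfand_spectrum A | gsrc Gd gz.1 = q gz.2],
      continuous (fun gz => bZ gz.1 gz.2)} ->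
    (forall g y, gsrc Gd g = p y -> phi (act g y) = bZ g (phi y)) ->
    (fun hy => phi (act hy.1 hy.2)) @ near_pair Gd p g z --> bZ g z.
  move=> cb bphi.
  have h : (fun hy => bZ hy.1 (phi hy.2)) @ near_pair Gd p g z --> bZ g z.
    apply: (within_continuous_cvg (x := (g, z))
      (w := fun hy => (hy.1, phi hy.2)) _ cb gz).
      exact: (cvg_pair cg cz).
    by apply: filterS gp => hy /D.
  apply: cvg_trans h; apply: near_eq_cvg.
  by apply: filterS gp => hy hp /=; rewrite bphi.
have L1 := lim aZ' (gsp_act_continuous gZ') aZ'phi.
apply: (@cvg_unique _ (fc_hausdorff fc) _ _ _ _ L1).
apply: lim; first exact: (extended_act_continuous lcG fA stA gm aZ_cvg).
by move=> h y hy; rewrite (extended_act_phi lcG fA gm aZ_cvg).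
Qed.

(** * The Stone-Cech algebra *)

Section quotient_and_positive_part.
Variables (R : realType) (T : topologicalType).
Local Notation C := (cplx R).
Implicit Types f g : T -> C.

Lemma continuous_normf f : continuous f -> continuous (fun x => `|f x| : C).
Proof. by move=> cf x; apply: cvg_norm; exact: cf. Qed.

Lemma continuous_divf f g : continuous f -> continuous g ->
  (forall x, g x != 0) -> continuous (fun x => f x / g x).
Proof.
move=> cf cg g0 x; apply: cvgM; first exact: cf.
by apply: cvgV; [exact: g0|exact: cg].
Qed.

(** This is the positive part on real numbers only; the formula with the norm is continuous on all
    of the complex numbers. *)
Definition pospart (t : C) : C := (t + `|t|) / 2.

Lemma pospart_ge0 (t : C) : 0 <= t -> pospart t = t.
Proof. by move=> t0; rewrite /pospart ger0_norm//; field. Qed.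

Lemma pospart_le0 (t : C) : t <= 0 -> pospart t = 0.
Proof. by move=> t0; rewrite /pospart ler0_norm// subrr mul0r. Qed.

Lemma continuous_pospart f : continuous f -> continuous (fun x => pospart (f x)).
Proof.
move=> cf x; apply: cvgM; last exact: cvg_cst.
by apply: cvgD; [exact: cf|exact: (continuous_normf cf)].
Qed.

End quotient_and_positive_part.

Section stone_cech.
Variables (R : realType) (X Y : topologicalType) (p : Y -> X).
Hypothesis cp : continuous p.
Local Notation C := (cplx R).
Local Notation B := (stone_cech_algebra (R := R) p).
Implicit Types (f g : Y -> C).

(** Level sets pass to dominated functions, which makes the closure properties easy. In one
    direction, a function within e/2 of [f] is nonzero wherever |f| >= e; in the other, an
    approximant has to be built. *)
Lemma stone_cech_algebraP f : B f <-> Cb f /\ forall e : C, 0 < e ->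
  exists2 K : set X, compact K & forall y, e <= `|f y| -> K (p y).
Proof.
split=> [[bf fg]|[bf fK]]; split=> // e e0.
  have e2 : 0 < e / 2 by rewrite divr_gt0.
  have [g [_ [K cK gK] gf]] := fg _ e2; exists K => // y ey.
  apply: gK; apply: subset_closure => /=; apply/negP => /eqP gy.
  have := gf y; rewrite gy subr0 => /(le_trans ey).
  by rewrite {1}(splitr e) gerDl => /(lt_le_trans e2); rewrite ltxx.
have [cf [M fM]] := bf.
have [K cK eK] := fK e e0.
(* Soft thresholding of f at level e. *)
pose m y : C := pospart (`|f y| - e).
have mP y : 0 <= m y /\ `|f y| <= m y + e.
  have [fe|ef] := real_leP (gtr0_real e0) (normr_real (f y)).
    by rewrite /m pospart_ge0 subr_ge0// subrK.
  by rewrite /m pospart_le0 ?subr_le0 ?(ltW ef)//; split=> //; rewrite add0r ltW.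
have me0 y : 0 < m y + e by rewrite ltr_wpDl// (mP y).1.
have cm : continuous m.
  apply: continuous_pospart => y.
  by apply: cvgB; [exact: (continuous_normf cf)|exact: cvg_cst].
have cme : continuous (fun y => m y + e).
  by move=> y; apply: cvgD; [exact: cm|exact: cvg_cst].
(* The error is |f| e / (m + e), at most [e] because |f| <= m + e. The approximant vanishes where
   |f| < e, so its closed support stays in the closed set |f| >= e. *)
exists (fun y => f y * (m y / (m y + e))); split.
- split.
    apply: (continuous_mulf cf); apply: (continuous_divf cm cme) => y.
    by rewrite gt_eqF.
  exists M => y; rewrite normrM (le_trans _ (fM y))// ler_piMr//.
  rewrite normrM normfV (gtr0_norm (me0 y)) (ger0_norm (mP y).1).
  by rewrite ler_pdivrMr// mul1r lerDl ltW.
- exists K => // y ym; apply: eK.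
  have clE := closed_norm_ge cf (gtr0_real e0).
  apply: clE; apply: closure_subset ym => x /=.
  apply: contra_neqT; rewrite -real_ltNge ?normr_real ?gtr0_real// => fe.
  by rewrite /m pospart_le0 ?subr_le0 ?(ltW fe)// mul0r mulr0.
- move=> y; have E : f y - f y * (m y / (m y + e)) = f y * e / (m y + e).
    by field; rewrite gt_eqF.
  rewrite E 2!normrM normfV (gtr0_norm e0) (gtr0_norm (me0 y)).
  by rewrite ler_pdivrMr// [`|f y| * e]mulrC ler_wpM2l ?(ltW e0)// (mP y).2.
Qed.

Lemma stone_cech_dominated f g (M : C) : B f -> continuous g -> 0 < M ->
  (forall y, `|g y| <= M * `|f y|) -> B g.
Proof.
move=> /stone_cech_algebraP[[_ [N fN]] fK] cg M0 gf; apply/stone_cech_algebraP.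
split.
  split=> //; exists (M * N) => y.
  by rewrite (le_trans (gf y))// ler_wpM2l// ltW.
move=> e e0; have [K cK eK] := fK (e / M) (divr_gt0 e0 M0).
exists K => // y ey; apply: eK.
by rewrite ler_pdivrMr// mulrC (le_trans ey).
Qed.

Lemma stone_cech_fibre_algebra : fibre_algebra p B.
Proof.
have bnd a : B a -> exists2 M : C, 0 < M & forall y, `|a y| <= M.
  move=> [[_ [M aM]] _]; exists (`|M| + 1) => [|y]; first by rewrite ltr_wpDl.
  have Mr : M \is Num.real by rewrite (ger0_real (le_trans (normr_ge0 _) (aM y))).
  by rewrite (le_trans (aM y))// (le_trans (real_ler_norm Mr))// lerDl.
have cont a : B a -> continuous a by move=> [[]].
split=> //.
- by move=> a e /stone_cech_algebraP[_]; apply.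
- move=> a a0; have [ca aL] := a0.
  have [M _ aM] := C0_bounded a0.
  apply/stone_cech_algebraP; split; first by split=> //; exists M.
  move=> e /aL eL; exists (p @` [set y | e <= `|a y|]).
    by apply: continuous_compact => //; exact: continuous_subspaceT.
  by move=> y ey; exists y.
- move=> f f0; have [cf fL] := f0.
  have [M _ fM] := C0_bounded f0.
  apply/stone_cech_algebraP; split.
    split; last by exists M => y; exact: fM.
    by move=> y; apply: continuous_comp; [exact: cp|exact: cf].
  by move=> e /fL eL; exists [set x | e <= `|f x|].
- move=> a b Aa Ab; have ca := cont _ Aa; have cb := cont _ Ab.
  have [M _ aM] := bnd _ Aa; have [N _ bN] := bnd _ Ab.
  apply/stone_cech_algebraP; split.
    split; first exact: (continuous_addf ca cb).
    by exists (M + N) => y; rewrite (le_trans (ler_normD _ _))// lerD.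
  move: Aa Ab => /stone_cech_algebraP[_ aK] /stone_cech_algebraP[_ bK] e e0.
  have e2 : 0 < e / 2 by rewrite divr_gt0.
  have [K cK eK] := aK _ e2; have [L cL eL] := bK _ e2.
  exists (K `|` L); first exact: compactU.
  move=> y /= ey; have e2r := gtr0_real e2.
  have [/eK|ay] := real_leP e2r (normr_real (a y)); first by left.
  have [/eL|yb] := real_leP e2r (normr_real (b y)); first by right.
  have := le_lt_trans (ler_normD _ _) (ltrD ay yb).
  by rewrite -splitr => /(le_lt_trans ey); rewrite ltxx.
- move=> k a Aa; have k0 : 0 < `|k| + 1 by rewrite ltr_wpDl.
  apply: (stone_cech_dominated Aa _ k0).
    by move=> y; apply: cvgM; [exact: cvg_cst|exact: cont].
  by move=> y /=; rewrite normrM ler_wpM2r// lerDl.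
- move=> a b Aa Ab; have [M M0 aM] := bnd _ Aa.
  apply: (stone_cech_dominated Ab _ M0).
    exact: (continuous_mulf (cont _ Aa) (cont _ Ab)).
  by move=> y /=; rewrite normrM ler_wpM2r.
- move=> a Aa; apply: (stone_cech_dominated Aa _ ltr01).
    exact: (continuous_conjf (cont _ Aa)).
  by move=> y; rewrite norm_conjC mul1r.
- move=> a c d Aa c0 d0 ad; have di : 0 < d^-1 by rewrite invr_gt0.
  apply: (stone_cech_dominated Aa _ di).
    have ca := cont _ Aa.
    have cac : continuous (fun y => a y + c).
      by move=> y; apply: cvgD; [exact: ca|exact: cvg_cst].
    apply: (continuous_divf ca cac) => y.
    by rewrite gt_eqF// (lt_le_trans d0).
  move=> y; rewrite normrM mulrC ler_wpM2r//.
  have ay : 0 < a y + c by rewrite (lt_le_trans d0).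
  by rewrite normfV gtr0_norm// lef_pV2.
Qed.

End stone_cech.

(** * The Alexandroff algebra *)

Section alexandroff.
Variables (R : realType) (X Y : topologicalType) (p : Y -> X).
Hypothesis cp : continuous p.
Local Notation C := (cplx R).
Local Notation B := (alexandroff_algebra (R := R) p).

Lemma C0_Re (T : topologicalType) (f : T -> C) :
  C0 f -> C0 (fun x => 'Re (f x) : C).
Proof.
move=> f0; have := C0_scale 2^-1 (C0_add f0 (C0_conj f0)).
by congr C0; apply/funext => x /=; rewrite ReE mulrC.
Qed.

(* The functions f and g are made real, and then f is replaced by max(f, m) with
   m < 0: a function which exceeds -c on Y may be smaller than -c off the closure
   of the range of p, or where g compensates. *)
Lemma alexandroff_lower_bound (a : Y -> C) (c d : C) : B a -> 0 < c -> 0 < d ->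
  (forall y, d <= a y + c) -> exists (f : X -> C) (g : Y -> C) (d' : C),
  [/\ C0 f, C0 g, 0 < d', (forall x, d' <= f x + c) & a = (f \o p) \+ g].
Proof.
move=> [h [k [h0 k0 aE]]] c0 d0 ac.
have c2 : 0 < c / 2 by rewrite divr_gt0.
(* The bound by c/2 makes [m] negative, so that truncating below at [m] preserves vanishing at
   infinity; the bound by [d] controls the correction on [Y]. *)
have [d' d'0 [d'd d'c]] := pos_lower_bound d0 c2.
pose m := d' - c.
have m0 : m < 0.
  by rewrite subr_lt0 (le_lt_trans d'c)// ltr_pdivrMr// ltr_pMr// ltr1n.
have mr : m \is Num.real by exact: ltr0_real.
pose h1 x : C := 'Re (h x); pose k1 y : C := 'Re (k y).
have h10 : C0 h1 by exact: C0_Re.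
have k10 : C0 k1 by exact: C0_Re.
have h1r x : h1 x \is Num.real by exact: Creal_Re.
have aE1 y : a y = h1 (p y) + k1 y.
  have ar : a y \is Num.real.
    by rewrite -(addrK c (a y)) rpredB ?gtr0_real// (lt_le_trans d0).
  by rewrite -[LHS](Creal_ReP _ ar) aE raddfD.
pose h2 x := m + pospart (h1 x - m).
have h2P x : h2 x = h1 x /\ m <= h1 x \/ h2 x = m /\ h1 x < m.
  have [mh|hm] := real_leP mr (h1r x); [left|right]; split=> //.
    by rewrite /h2 pospart_ge0 ?subr_ge0// addrC subrK.
  by rewrite /h2 pospart_le0 ?subr_le0 ?(ltW hm)// addr0.
have ch2 : continuous h2.
  move=> x; apply: cvgD; first exact: cvg_cst.
  apply: (@continuous_pospart _ _ (fun x => h1 x - m)) => x'.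
  by apply: cvgB; [case: h10 => ch _; exact: ch|exact: cvg_cst].
have h20 : C0 h2.
  apply: (C0_dominated h10 ch2 ltr01) => x; rewrite mul1r.
  have [[-> _]//|[-> hm]] := h2P x.
  by rewrite (ltr0_norm m0) (ltr0_norm (lt_trans hm m0)) lerN2 ltW.
pose D y := h2 (p y) - h1 (p y).
(* Where h1(p y) < m, the inequality a + c >= d >= d' forces k1(y) >= m - h1(p y). So the correction
   is dominated by [k1]. *)
have D0 : C0 D.
  have cD : continuous D.
    move=> y; apply: cvgB.
      by apply: continuous_comp; [exact: cp|exact: ch2].
    by apply: continuous_comp; [exact: cp|case: h10 => ch _; exact: ch].
  apply: (C0_dominated k10 cD ltr01) => y; rewrite mul1r /D.
  have [[-> _]|[-> hm]] := h2P (p y); first by rewrite subrr normr0.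
  have Dk : m - h1 (p y) <= k1 y.
    rewrite lerBlDr [k1 y + _]addrC -aE1 /m lerBlDr.
    exact: (le_trans d'd).
  have D0 : 0 <= m - h1 (p y) by rewrite subr_ge0 ltW.
  by rewrite (ger0_norm D0) (ger0_norm (le_trans D0 Dk)).
exists h2, (k1 \+ (-1 \*o D)), d'; split=> //.
- by apply: C0_add => //; exact: C0_scale.
- move=> x; have [[-> mh]|[-> _]] := h2P x; last by rewrite /m subrK.
  by rewrite -lerBlDr.
- by apply/funext => y; rewrite aE1 /= /D mulN1r; ring.
Qed.

Lemma alexandroff_fibre_algebra : fibre_algebra p B.
Proof.
have cpb (f : X -> C) : C0 f -> continuous (f \o p).
  by move=> [cf _] y; apply: continuous_comp; [exact: cp|exact: cf].
have cont a : B a -> continuous a.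
  by move=> [f [g [f0 [cg _] ->]]]; exact: (continuous_addf (cpb _ f0) cg).
split=> //.
- move=> a [f [g [f0 g0 ->]]].
  have [M M0 fM] := C0_bounded f0; have [N N0 gN] := C0_bounded g0.
  exists (M + N) => [|y]; first exact: addr_gt0.
  by rewrite (le_trans (ler_normD _ _))// lerD//; exact: fM.
- move=> a e [f [g [[cf fL] [cg gL] ->]]] e0.
  have e2 : 0 < e / 2 by rewrite divr_gt0.
  exists ([set x | e / 2 <= `|f x|] `|` p @` [set y | e / 2 <= `|g y|]).
    apply: compactU; first exact: fL.
    apply: continuous_compact; last exact: gL.
    exact: continuous_subspaceT.
  move=> y /= ey; have e2r := gtr0_real e2.
  have [?|fy] := real_leP e2r (normr_real (f (p y))); first by left.
  have [?|gy] := real_leP e2r (normr_real (g y)); first by right; exists y.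
  have := le_lt_trans (ler_normD _ _) (ltrD fy gy).
  by rewrite -splitr => /(le_lt_trans ey); rewrite ltxx.
- move=> g g0; exists (cst 0), g; split=> //; first exact: C0_0.
  by apply/funext => y /=; rewrite add0r.
- move=> f f0; exists f, (cst 0); split=> //; first exact: C0_0.
  by apply/funext => y /=; rewrite addr0.
- move=> a b [f [g [f0 g0 ->]]] [f' [g' [f'0 g'0 ->]]].
  exists (f \+ f'), (g \+ g'); split; [exact: C0_add|exact: C0_add|].
  by apply/funext => y /=; rewrite addrACA.
- move=> k a [f [g [f0 g0 ->]]].
  exists (k \*o f), (k \*o g); split; [exact: C0_scale|exact: C0_scale|].
  by apply/funext => y /=; rewrite mulrDr.
- move=> a b [f [g [f0 g0 ->]]] [f' [g' [f'0 g'0 ->]]].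
  have [M M0 fM] := C0_bounded f0; have [M' M'0 f'M] := C0_bounded f'0.
  have [N N0 gN] := C0_bounded g0.
  exists (f \* f'), ((f \o p) \* g' \+ ((f' \o p) \* g \+ g \* g')); split.
  + by case: f0 => cf _; exact: (C0_mul f'0 cf M0).
  + apply: C0_add; first by apply: (C0_mul g'0 (cpb _ f0) M0) => y; exact: fM.
    apply: C0_add; first by apply: (C0_mul g0 (cpb _ f'0) M'0) => y; exact: f'M.
    by case: g0 => cg _; exact: (C0_mul g'0 cg N0).
  + by apply/funext => y /=; ring.
- move=> a [f [g [f0 g0 ->]]].
  exists (fun x => (f x)^*), (fun y => (g y)^*).
  split; [exact: C0_conj|exact: C0_conj|].
  by apply/funext => y /=; rewrite rmorphD.
- move=> a c d Ba c0 d0 ad.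
  have [f [g [d' [f0 g0 d'0 fd' aE]]]] := alexandroff_lower_bound Ba c0 d0 ad.
  have ca := cont _ Ba.
  have an y : 0 < a y + c by exact: (lt_le_trans d0).
  have fn x : 0 < f x + c by exact: (lt_le_trans d'0).
  have cfc : continuous (fun x => f x + c).
    by move=> x; apply: cvgD; [case: f0 => cf _; exact: cf|exact: cvg_cst].
  (* With a = f o p + g, the difference of a / (a + c) and (f / (f + c)) o p is c g / ((a + c) (f o
     p + c)). Both denominators are bounded below, so each term is dominated by [f] or [g]. *)
  exists (fun x => f x / (f x + c)),
    (fun y => c * g y / ((a y + c) * (f (p y) + c))); split.
  + have di : 0 < d'^-1 by rewrite invr_gt0.
    have cq : continuous (fun x => f x / (f x + c)).
      by case: f0 => cf _; apply: (continuous_divf cf cfc) => x; rewrite gt_eqF.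
    apply: (C0_dominated f0 cq di) => x.
    by rewrite normrM mulrC ler_wpM2r// normfV (gtr0_norm (fn x)) lef_pV2 ?posrE.
  + have di : 0 < c / (d * d') by rewrite divr_gt0// mulr_gt0.
    have cn : continuous (fun y => c * g y).
      by move=> y; apply: cvgM; [exact: cvg_cst|case: g0 => cg _; exact: cg].
    have cd : continuous (fun y => (a y + c) * (f (p y) + c)).
      move=> y; apply: cvgM.
        by apply: cvgD; [exact: ca|exact: cvg_cst].
      by apply: cvgD; [exact: (cpb _ f0)|exact: cvg_cst].
    have cq : continuous (fun y => c * g y / ((a y + c) * (f (p y) + c))).
      by apply: (continuous_divf cn cd) => y; rewrite gt_eqF// mulr_gt0.
    apply: (C0_dominated g0 cq di) => y.
    rewrite 2!normrM (gtr0_norm c0) mulrAC ler_wpM2r// ler_wpM2l ?(ltW c0)//.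
    have p0 : 0 < (a y + c) * (f (p y) + c) by rewrite mulr_gt0.
    rewrite normfV gtr0_norm// lef_pV2 ?posrE ?mulr_gt0//.
    by rewrite ler_pM// ltW.
  + apply/funext => y /=; rewrite aE /=.
    have := an y; rewrite aE /= => /gt_eqF an0; have /gt_eqF fn0 := fn (p y).
    by field; rewrite an0 fn0.
Qed.

End alexandroff.

(** * Bisections *)

Lemma closed_equalizer (S T : topologicalType) (f g : S -> T) :
  hausdorff_space T -> continuous f -> continuous g ->
  closed [set x | f x = g x].
Proof.
move=> hT cf cg x clx; apply: hT => U V fU gV.
have fgUV : nbhs x (f @^-1` U `&` g @^-1` V).
  by apply: filterI; [exact: cf|exact: cg].
have [t [fgt [Ut Vt]]] := clx _ fgUV.
by exists (f t); split=> //; rewrite fgt.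
Qed.

Section bisection.
Variables (G X : topologicalType) (Gd : groupoid G X).
Hypotheses (lcG : locally_compact_groupoid Gd) (etG : etale Gd).
Local Notation s := (gsrc Gd).
Local Notation r := (grng Gd).

Lemma ginvK : involutive (ginv Gd).
Proof.
move=> g; rewrite -[LHS](gmulg1 Gd) gsrc_inv grng_inv -gmulVg.
rewrite gmulA ?gsrc_inv ?grng_inv//.
by rewrite gmulVg gsrc_inv gmul1g.
Qed.

(** Étaleness concerns [r], so it is applied at the inverse of [g0] and carried over by inversion to
    make [s] injective on [U]. The inverse [sigma] is continuous because [s] is open. *)
Lemma source_section (g0 : G) : exists U (sigma : X -> G),
  [/\ open U, U g0, open (s @` U), (forall h, U h -> sigma (s h) = h) &
      forall h, U h -> {for s h, continuous sigma}].
Proof.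
have [U' [oU' U'g [_ injU' _]]] := etG (ginv Gd g0).
pose U := ginv Gd @^-1` U'.
have oU : open U.
  by apply: open_comp => // h _; exact: (lcg_inv_continuous lcG).
have injU h h' : U h -> U h' -> s h = s h' -> h = h'.
  move=> Uh Uh' hh'; rewrite -(ginvK h) -(ginvK h'); congr (ginv Gd _).
  by apply: injU'; rewrite ?inE// !grng_inv.
have [sigma sE] : exists sigma : X -> G, forall h, U h -> sigma (s h) = h.
  suff /choice[sigma sE] : forall x, exists k, forall h, U h -> s h = x -> k = h.
    by exists sigma => h Uh; exact: sE.
  move=> x; have [[k [Uk kx]]|nx] := pselect (exists k, U k /\ s k = x).
    by exists k => h Uh hx; apply: injU => //; rewrite hx.
  by exists g0 => h Uh hx; case: nx; exists h.
exists U, sigma; split=> //; first exact: (lcg_src_open lcG).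
move=> h Uh W; rewrite /= sE// => Wh.
have UW : nbhs h (U `&` W) by apply: filterI => //; exact: open_nbhs_nbhs.
apply: filterS (src_near lcG UW erefl) => _ [k [Uk Wk] <-] /=.
by rewrite sE.
Qed.

Variables (R : realType).
Local Notation C := (cplx R).

(** * Translation of functions along a bisection *)

Section pulled_function.
Variables (Y : topologicalType) (p : Y -> X) (act : G -> Y -> Y).
Hypothesis gspY : left_gspace Gd p act.
Variables (U : set G) (sigma : X -> G) (f : X -> C) (K : set X).
Hypotheses (oV : open (s @` U)) (sE : forall h, U h -> sigma (s h) = h).
Hypothesis csigma : forall h, U h -> {for s h, continuous sigma}.
Hypotheses (cf : continuous f) (f1 : forall x, `|f x| <= 1).
Hypotheses (cK : compact K) (KV : K `<=` s @` U).
Hypothesis fK : forall x, f x != 0 -> K x.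

(** Over points outside the source image of [U], [sigma] is unconstrained, but there [f]
    vanishes. *)
Definition pulled (a : Y -> C) (y : Y) : C := f (p y) * a (act (sigma (p y)) y).

Let cp := gsp_anchor_continuous gspY.

Lemma src_sigma x : (s @` U) x -> s (sigma x) = x.
Proof. by move=> [h Uh <-]; rewrite sE. Qed.

Lemma continuous_sigma x : (s @` U) x -> {for x, continuous sigma}.
Proof. by move=> [h Uh <-]; exact: csigma. Qed.

(** Over the open source image of [U] this is a composite of continuous maps. Any other point lies
    over the complement of the closed set [K], where the function is 0. *)
Lemma continuous_pulled a : continuous a -> continuous (pulled a).
Proof.
move=> ca y; have [Vy|nVy] := pselect ((s @` U) (p y)).
  apply: cvgM; first by apply: continuous_comp; [exact: cp|exact: cf].
  have cact : (fun y' => act (sigma (p y')) y') @ y --> act (sigma (p y)) y.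
    apply: (within_continuous_cvg (x := (sigma (p y), y))
      (w := fun y' => (sigma (p y'), y')) _ (gsp_act_continuous gspY)).
    - exact: src_sigma.
    - apply: cvg_pair; last exact: cvg_id.
      exact: (continuous_comp (@cp y) (continuous_sigma Vy)).
    - have : \forall y' \near y, (s @` U) (p y').
        by apply: cp; exact: open_nbhs_nbhs.
      by apply: filterS => y' /src_sigma.
  exact: (cvg_comp _ _ cact (ca _)).
have f0 x : ~ K x -> f x = 0 by move=> nK; apply/eqP/negPn/negP => /fK.
have nK : ~ K (p y) by move=> /KV.
have oK : open (~` K).
  by rewrite openC; exact: (compact_closed (hausdorff_units lcG) cK).
have py0 : pulled a y = 0 by rewrite /pulled f0// mul0r.
rewrite /continuous_at py0.
apply: cvg_trans (@cvg_cst _ (0 : C) _ (nbhs y) _).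
apply: near_eq_cvg.
have : \forall y' \near y, (~` K) (p y').
  by apply: cp; exact: open_nbhs_nbhs.
by apply: filterS => y' /f0 fy'; rewrite /pulled fy' mul0r.
Qed.

Lemma pulled_support a y : pulled a y != 0 -> K (p y).
Proof.
move=> ay; apply: fK; apply: contraNN ay => /eqP fy.
by rewrite /pulled fy mul0r.
Qed.

Lemma pulled_le a y : `|pulled a y| <= `|a (act (sigma (p y)) y)|.
Proof. by rewrite normrM ler_piMl. Qed.

(** A point y of a level set is recovered as h^-1 (h y), with h in the compact set sigma(K) and h y
    in a compact level set of [a]. So the level set is covered by the image of a compact set of
    composable pairs. *)
Lemma pulled_C0 a : C0 a -> C0 (pulled a).
Proof.
move=> [ca aL]; apply: C0_of_subcompact; first exact: continuous_pulled.
move=> e e0; set L := [set y | e <= `|a y|].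
have cL : compact L := aL e e0.
have cS : compact (sigma @` K).
  apply: continuous_compact => //; apply: continuous_in_subspaceT => x.
  by rewrite inE => /KV; exact: continuous_sigma.
pose P := (sigma @` K `*` L) `&` [set gy : G * Y | r gy.1 = p gy.2].
have cP : compact P.
  apply: compact_closedI; first exact: compact_setX.
  apply: (@closed_equalizer _ _ (fun gy : G * Y => r gy.1) (fun gy => p gy.2)).
  - exact: (hausdorff_units lcG).
  - by move=> gy; apply: continuous_comp;
      [exact: cvg_fst|exact: (lcg_rng_continuous lcG)].
  - by move=> gy; apply: continuous_comp; [exact: cvg_snd|exact: cp].
exists ((fun gy : G * Y => act (ginv Gd gy.1) gy.2) @` P).
  apply: continuous_compact => //; apply/subspace_continuousP => -[g y'] [_ /= gyP].
  have c0 : fst @ within P (nbhs (g, y')) --> g.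
    by apply: cvg_within_filter; exact: cvg_fst.
  have c1 : (fun gy : G * Y => ginv Gd gy.1) @ within P (nbhs (g, y')) -->
      ginv Gd g.
    exact: (cvg_comp _ _ c0 (@lcg_inv_continuous _ _ _ lcG g)).
  have c2 : snd @ within P (nbhs (g, y')) --> y'.
    by apply: cvg_within_filter; exact: cvg_snd.
  apply: (within_continuous_cvg (x := (ginv Gd g, y'))
      (w := fun gy => (ginv Gd gy.1, gy.2)) _ (gsp_act_continuous gspY)).
  - by rewrite /= gsrc_inv.
  - exact: (cvg_pair c1 c2).
  - apply: filterS (withinT P _) => hy [_ /= hyP].
    by rewrite gsrc_inv.
move=> y /= ey.
have y0 : pulled a y != 0 by rewrite -normr_gt0 (lt_le_trans e0).
have Ky := pulled_support y0.
have sy := src_sigma (KV Ky).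
exists (sigma (p y), act (sigma (p y)) y).
  split; last by rewrite /= (gsp_anchor gspY).
  split; first by exists (p y).
  by rewrite /L /= (le_trans ey)// pulled_le.
rewrite /= -(gsp_mul gspY) ?gsrc_inv// gmulVg sy.
exact: (gsp_unit gspY).
Qed.

End pulled_function.

(** Allows [pulled_C0] to be applied to functions on the unit space, for the summand p^*C_0(X). *)
Lemma units_left_gspace : left_gspace Gd id (fun g _ => r g).
Proof.
split=> //.
- exact: (locally_compact_units lcG).
- exact: (hausdorff_units lcG).
- by move=> x; exact: cvg_id.
- apply: continuous_subspaceT => gx; apply: continuous_comp.
    exact: cvg_fst.
  exact: (lcg_rng_continuous lcG).
- by move=> x; exact: grng_unit.
- by move=> g2 g1 x _ g21; rewrite grng_mul.
Qed.

(** * Stability of the two algebras under translation *)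

Section algebras_stable.
Variables (Y : topologicalType) (p : Y -> X) (act : G -> Y -> Y).
Hypothesis gspY : left_gspace Gd p act.

Lemma stone_cech_stable : action_stable Gd p act (stone_cech_algebra (R := R) p).
Proof.
move=> g0; have [U [sigma [oU Ug oV sE csigma]]] := source_section g0.
have [f [f0 fg f1] [K [cK KV] fK]] := C0_urysohn R (locally_compact_units lcG)
  (hausdorff_units lcG) oV (imageP s Ug).
have cf := f0.1.
exists U, f; split=> // a [[ca [M aM]] _].
exists (pulled p act sigma f a); last first.
  by move=> h y Uh hy; rewrite /pulled -hy sE.
apply/stone_cech_algebraP; split.
  split; first exact: (continuous_pulled gspY oV sE csigma cf cK KV fK ca).
  by exists M => y; rewrite (le_trans _ (aM (act (sigma (p y)) y)))// pulled_le.
move=> e e0; exists K => // y ey.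
apply: (pulled_support fK (act := act) (sigma := sigma) (a := a)).
by rewrite -normr_gt0 (lt_le_trans e0).
Qed.

(** Since p(h y) = r(h), translating h o p gives a function of p(y) alone, the translate of h on the
    unit space. The two summands are thus treated separately. *)
Lemma alexandroff_stable : action_stable Gd p act (alexandroff_algebra (R := R) p).
Proof.
move=> g0; have [U [sigma [oU Ug oV sE csigma]]] := source_section g0.
have [f [f0 fg f1] [K [cK KV] fK]] := C0_urysohn R (locally_compact_units lcG)
  (hausdorff_units lcG) oV (imageP s Ug).
have cf := f0.1.
exists U, f; split=> // a [h [k [h0 k0 ->]]].
exists (pulled p act sigma f ((h \o p) \+ k)); last first.
  by move=> g y Ug' gy; rewrite /pulled -gy sE.
exists (pulled id (fun g _ => r g) sigma f h), (pulled p act sigma f k).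
split.
- exact: (pulled_C0 units_left_gspace oV sE csigma cf f1 cK KV fK).
- exact: (pulled_C0 gspY oV sE csigma cf f1 cK KV fK).
apply/funext => y /=; rewrite /pulled /=.
have [->|fy] := eqVneq (f (p y)) 0; first by rewrite !mul0r addr0.
by rewrite (gsp_anchor gspY) ?mulrDr//; exact: (src_sigma sE (KV _ (fK _ fy))).
Qed.

End algebras_stable.

End bisection.

Theorem proposition3p8 (R : realType) (G X Y : topologicalType)
    (Gd : groupoid G X) (p : Y -> X) (act : G -> Y -> Y)
    (lcG : locally_compact_groupoid Gd) (etG : etale Gd)
    (scY : @second_countable Y) (gspY : left_gspace Gd p act) :
  action_extends_uniquely Gd p act (alexandroff_algebra (R := R) p) /\
  action_extends_uniquely Gd p act (stone_cech_algebra (R := R) p).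
Proof.
have cp := gsp_anchor_continuous gspY.
split; apply: gelfand_action_extends_uniquely => //.
- exact: alexandroff_fibre_algebra.
- exact: alexandroff_stable.
- exact: stone_cech_fibre_algebra.
- exact: stone_cech_stable.
Qed.
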